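(* Let $(q_k)_{k\in\mathbb Z},(r_k)_{k\in\mathbb Z}$ be rapidly vanishing complex potentials and let $L$ and $L^{-1}$ be the sum-difference operators defined in the context. Let $a(z),\hat a(z)$ be the scattering coefficients of the discrete Zakharov--Shabat problem (see context) and $H_0=-\sum_{k=-\infty}^\infty\log(1-r_kq_k)$. Then $L$ and $L^{-1}$ satisfy the resolvent identities $$(I-z^{-2}L)^{-1}(r_k,q_k)^T=(1-r_kq_k)\left(\delta_k\log a+\delta_kH_0\right),$$ $$(I-z^{2}L^{-1})^{-1}(r_k,q_k)^T=(1-r_kq_k)\left(\delta_k\log\hat a+\delta_kH_0\right).$$
   Context: The potentials $q_k,r_k$ are complex-valued and vanish rapidly as $k\to\pm\infty$ (so that all sums and products converge), with $1-r_kq_k\neq0$. Operators. For a sequence $w=(u_k,v_k)^T_{k\in\mathbb Z}$ of vectors in $\mathbb C^2$, put $s_j=\dfrac{q_ju_j-r_jv_j}{1-r_jq_j}$. The operators $L$ and $L^{-1}$ (integration constants set to zero) are $$(Lw)_k=\begin{pmatrix} u_{k-1}-(1-r_kq_k)\,r_{k-1}\sum_{j\ge k}s_j-r_k\sum_{j\ge k}(q_ju_{j-1}-r_jv_{j+1})\\[2pt] v_{k+1}-(1-r_kq_k)\,q_{k+1}\sum_{j\ge k+1}s_j-q_k\sum_{j\ge k+1}(q_ju_{j-1}-r_jv_{j+1})\end{pmatrix},$$ $$(L^{-1}w)_k=\begin{pmatrix} u_{k+1}+(1-r_kq_k)\,r_{k+1}\sum_{j\ge k+1}s_j+r_k\sum_{j\ge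 k+1}(q_ju_{j+1}-r_jv_{j-1})\\[2pt] v_{k-1}+(1-r_kq_k)\,q_{k-1}\sum_{j\ge k}s_j+q_k\sum_{j\ge k}(q_ju_{j+1}-r_jv_{j-1})\end{pmatrix}.$$ The resolvents are used through their expansions $(I-z^{-2}L)^{-1}=\sum_{n\ge0}z^{-2n}L^n$ (expansion at $z=\infty$) and $(I-z^2L^{-1})^{-1}=\sum_{n\ge0}z^{2n}(L^{-1})^n$ (expansion at $z=0$). Scattering data. Consider $\nu_{k+1}=\begin{pmatrix} z & q_k\\ r_k & 1/z\end{pmatrix}\nu_k$, with solutions determined by $\phi_k\sim z^k(1,0)^T$, $\hat\phi_k\sim z^{-k}(0,1)^T$ as $k\to-\infty$ and $\psi_k\sim z^{-k}(0,1)^T$, $\hat\psi_k\sim z^k(1,0)^T$ as $k\to+\infty$. The coefficients $a,b,\hat a,\hat b$ are defined by $\phi_k=b\psi_k+a\hat\psi_k$, $\hat\phi_k=\hat a\psi_k+\hat b\hat\psi_k$; $a(z)$ is analytic for $|z|>1$ and $\hat a(z)$ for $|z|<1$. For a functional $F$ of $(q,r)$, $\delta_kF=(\delta F/\delta q_k,\ \delta F/\delta r_k)^T$ is the variational derivative at site $k$ (with $z$ fixed). *)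

(* Defs.v *)
(* Stdlib real numbers with Coquelicot's complex numbers. *)
From Stdlib Require Import Reals ZArith.
From Coquelicot Require Import Coquelicot.

Open Scope C_scope.

Definition zpow (z : C) (k : Z) : C :=
  match k with
  | Z0 => RtoC 1
  | Zpos p => Cpow z (Pos.to_nat p)
  | Zneg p => / Cpow z (Pos.to_nat p)
  end.

Definition cexp (z : C) : C :=
  (exp (Re z) * cos (Im z), exp (Re z) * sin (Im z))%R.

(* [lg] is a continuous (hence holomorphic) branch of the logarithm on the
   open set [U].  The values 1 - r_k q_k may lie on the cut of the principal
   logarithm; since they accumulate only at 1, some ray from 0 avoids 1 and all
   of them, and its complement carries a branch with lg 1 = 0. *)
Definition log_branch (U : C -> Prop) (lg : C -> C) : Prop :=
  open U /\ (forall w, U w -> continuous lg w) /\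
  (forall w, U w -> cexp (lg w) = w).

(* Totalised sums: they are meaningful only for convergent series. *)
Definition CSeries (f : nat -> C) : C :=
  (Series (fun n => Re (f n)), Series (fun n => Im (f n))).

Definition sum_from (k : Z) (f : Z -> C) : C :=
  CSeries (fun n => f (k + Z.of_nat n)%Z).

Definition sum_Z (f : Z -> C) : C :=
  sum_from 0 f + sum_from 1 (fun j => f (- j)%Z).

(* "Rapidly vanishing" is read as absolute summability over Z, which is what
   makes all the sums and products below converge; every class of faster
   decaying sequences is contained in this one. *)
Definition vanishes_rapidly (q : Z -> C) : Prop :=
  ex_series (fun n => Cmod (q (Z.of_nat n))) /\
  ex_series (fun n => Cmod (q (- Z.of_nat n)%Z)).

Definition scale (c : C) (x : C * C) : C * C := (c * fst x, c * snd x).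
Definition vadd (x y : C * C) : C * C := (fst x + fst y, snd x + snd y).

Definition s_term (q r : Z -> C) (w : Z -> C * C) (j : Z) : C :=
  (q j * fst (w j) - r j * snd (w j)) / (RtoC 1 - r j * q j).

Definition opL (q r : Z -> C) (w : Z -> C * C) (k : Z) : C * C :=
  let s := s_term q r w in
  let t j := q j * fst (w (j - 1)%Z) - r j * snd (w (j + 1)%Z) in
  (fst (w (k - 1)%Z)
     - (RtoC 1 - r k * q k) * r (k - 1)%Z * sum_from k s
     - r k * sum_from k t,
   snd (w (k + 1)%Z)
     - (RtoC 1 - r k * q k) * q (k + 1)%Z * sum_from (k + 1) s
     - q k * sum_from (k + 1) t).

Definition opLinv (q r : Z -> C) (w : Z -> C * C) (k : Z) : C * C :=
  let s := s_term q r w in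
  let t j := q j * fst (w (j + 1)%Z) - r j * snd (w (j - 1)%Z) in
  (fst (w (k + 1)%Z)
     + (RtoC 1 - r k * q k) * r (k + 1)%Z * sum_from (k + 1) s
     + r k * sum_from (k + 1) t,
   snd (w (k - 1)%Z)
     + (RtoC 1 - r k * q k) * q (k - 1)%Z * sum_from k s
     + q k * sum_from k t).

(* (I - c T)^{-1} w = v, the resolvent being the Neumann series
   sum_n c^n T^n, convergent at every site. *)
Definition is_resolvent (T : (Z -> C * C) -> Z -> C * C) (c : C)
    (w v : Z -> C * C) : Prop :=
  forall k : Z,
    is_series (K := C_AbsRing) (V := C_NormedModule)
      (fun n => Cpow c n * fst (Nat.iter n T w k)) (fst (v k)) /\
    is_series (K := C_AbsRing) (V := C_NormedModule)
      (fun n => Cpow c n * snd (Nat.iter n T w k)) (snd (v k)).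

Definition zs_solution (q r : Z -> C) (z : C) (nu : Z -> C * C) : Prop :=
  forall k : Z,
    nu (k + 1)%Z = (z * fst (nu k) + q k * snd (nu k),
                    r k * fst (nu k) + / z * snd (nu k)).

Definition tends_plus (f : Z -> C * C) (l : C * C) : Prop :=
  filterlim (fun n => f (Z.of_nat n)) eventually (locally l).

Definition tends_minus (f : Z -> C * C) (l : C * C) : Prop :=
  filterlim (fun n => f (- Z.of_nat n)%Z) eventually (locally l).

Definition is_phi (q r : Z -> C) (z : C) (nu : Z -> C * C) : Prop :=
  zs_solution q r z nu /\
  tends_minus (fun k => scale (zpow z (- k)) (nu k)) (RtoC 1, RtoC 0).

Definition is_phihat (q r : Z -> C) (z : C) (nu : Z -> C * C) : Prop :=
  zs_solution q r z nu /\
  tends_minus (fun k => scale (zpow z k) (nu k)) (RtoC 0, RtoC 1).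

Definition is_psi (q r : Z -> C) (z : C) (nu : Z -> C * C) : Prop :=
  zs_solution q r z nu /\
  tends_plus (fun k => scale (zpow z k) (nu k)) (RtoC 0, RtoC 1).

Definition is_psihat (q r : Z -> C) (z : C) (nu : Z -> C * C) : Prop :=
  zs_solution q r z nu /\
  tends_plus (fun k => scale (zpow z (- k)) (nu k)) (RtoC 1, RtoC 0).

(* On |z| = 1 the four solutions are unique.  For |z| > 1 the asymptotics
   still determine phi and psi, and determine psihat up to a multiple of psi;
   that ambiguity changes only b, so a(z) is well defined for |z| >= 1 and is
   the analytic continuation of its values on the circle.  Likewise ahat(z)
   for 0 < |z| <= 1, where psi is determined up to a multiple of psihat. *)
Definition is_scat_a (q r : Z -> C) (z a : C) : Prop :=
  exists (phi psi psihat : Z -> C * C) (b : C),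
    is_phi q r z phi /\ is_psi q r z psi /\ is_psihat q r z psihat /\
    forall k, phi k = vadd (scale b (psi k)) (scale a (psihat k)).

Definition is_scat_ahat (q r : Z -> C) (z ahat : C) : Prop :=
  exists (phihat psi psihat : Z -> C * C) (bhat : C),
    is_phihat q r z phihat /\ is_psi q r z psi /\ is_psihat q r z psihat /\
    forall k, phihat k = vadd (scale ahat (psi k)) (scale bhat (psihat k)).

Definition scat_a (q r : Z -> C) (z : C) : C :=
  iota (is_scat_a q r z : C_CompleteNormedModule -> Prop).

Definition scat_ahat (q r : Z -> C) (z : C) : C :=
  iota (is_scat_ahat q r z : C_CompleteNormedModule -> Prop).

Definition H0 (lg : C -> C) (q r : Z -> C) : C :=
  - sum_Z (fun k => lg (RtoC 1 - r k * q k)).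

Definition update (q : Z -> C) (k : Z) (t : C) : Z -> C :=
  fun j => if Z.eq_dec j k then t else q j.

(* d = (dF/dq_k, dF/dr_k), complex derivatives at the potentials (q, r). *)
Definition is_vderiv (F : (Z -> C) -> (Z -> C) -> C) (q r : Z -> C) (k : Z)
    (d : C * C) : Prop :=
  is_derive (K := C_AbsRing) (V := C_NormedModule)
    (fun t => F (update q k t) r) (q k) (fst d) /\
  is_derive (K := C_AbsRing) (V := C_NormedModule)
    (fun t => F q (update r k t)) (r k) (snd d).

(* Main.v *)
Require Import Defs.
From Stdlib Require Import Reals ZArith Lia Lra Psatz.
From Stdlib Require Import FunctionalExtensionality IndefiniteDescription.
From Coquelicot Require Import Coquelicot.

(** The idea is to solve for the right-hand side in closed form and to check
    that it is a fixed point of w |-> (r, q) + z^{-2} L w.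

    Jost solutions.  With X_k = z^{-k} phi_k the scattering problem reads
    X_{k+1} = M_k X_k, where M_k has rows (1, q_k/z) and (r_k/z, z^{-2}), and
    X tends to e1 = (1, 0) at -oo.  Let l be the row vector solution of
    l_k = l_{k+1} M_k that tends to e1 at +oo.  Both exist for |z| >= 1 as
    limits of products of matrices at summable distance from diagonal
    contractions ([jost_exists], [jost_unique]).  The number l_k X_k does not
    depend on k, and at k = +oo it is the first component of X, that is a(z)
    ([scat_a_eq]).

    Gradient.  The potentials at site k enter a = l_{k+1} M_k X_k through M_k
    alone, so a is affine in each of q_k and r_k, and
      delta_k a = z^{-1} (l^1_{k+1} X^2_k, l^2_{k+1} X^1_k).
    Also (1 - r_k q_k) delta_k H0 = (r_k, q_k).  Hence the right-hand side of the
    identity is explicit ([log_scat_a_vderiv], [H0_vderiv], [grad_sum]).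

    Fixed point.  The rank one matrices P_k = X_k l_k / a have trace one and
    satisfy P_{k+1} M_k = M_k P_k.  In terms of their entries the summands of the
    two half-line sums in L telescope, and what is left of the fixed point
    equation is an identity at each site ([grad_sum_fixed]).

    Neumann series.  L is bounded on bounded sequences, with a bound that does
    not involve z.  For large |z| the operator z^{-2} L is a contraction, so the
    bounded fixed point is the sum of the Neumann series ([neumann]).  Since
    a(z) -> 1 as z -> oo ([scat_a_near_1]), the logarithm of a is defined there.

    The second identity is the image of the first one under exchanging the two
    components, q with r, and z with 1/z: this carries L to L^{-1} and a to
    ahat ([opLinv_swap], [scat_ahat_eq]). *)

Open Scope C_scope.

(** * Limits of complex sequences and series *)

Lemma Cmod_minus_sym (x y : C) : Cmod (x - y) = Cmod (y - x).
Proof. rewrite <- Cmod_opp. f_equal. ring. Qed.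

Lemma im_le_Cmod (c : C) : (Rabs (Im c) <= Cmod c)%R.
Proof. apply Rle_trans with (2 := Rmax_Cmod c). apply Rmax_r. Qed.

Lemma Cmod_le_Re_Im (c : C) : (Cmod c <= Rabs (Re c) + Rabs (Im c))%R.
Proof.
  assert (E : c = RtoC (Re c) + Ci * RtoC (Im c)).
  { destruct c as [x y]. unfold RtoC, Ci, Cplus, Cmult; simpl. f_equal; ring. }
  rewrite E at 1.
  eapply Rle_trans; [apply Cmod_triangle|].
  rewrite Cmod_mult, Cmod_R, Cmod_R.
  replace (Cmod Ci) with 1%R; [lra|].
  unfold Cmod, Ci; simpl. replace (0 * (0 * 1) + 1 * (1 * 1))%R with 1%R by ring.
  now rewrite sqrt_1.
Qed.

(** Phrased as a real limit so that squeezing and the arithmetic of real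
    limits apply. *)
Definition Clim (u : nat -> C) (l : C) : Prop :=
  is_lim_seq (fun n => Cmod (u n - l)) 0.

Lemma lim0_squeeze (u v : nat -> R) :
  (forall n, Rabs (u n) <= v n)%R -> is_lim_seq v 0 -> is_lim_seq u 0.
Proof.
  intros H Hv. apply is_lim_seq_abs_0.
  apply is_lim_seq_le_le with (fun _ => 0%R) v; auto using is_lim_seq_const.
  intros n. split; [apply Rabs_pos | apply H].
Qed.

Lemma Clim_dominated (u : nat -> C) (l : C) (v : nat -> R) :
  (forall n, Cmod (u n - l) <= v n)%R -> is_lim_seq v 0 -> Clim u l.
Proof.
  intros H Hv. apply lim0_squeeze with v; auto.
  intros n. rewrite Rabs_pos_eq; auto using Cmod_ge_0.
Qed.

Lemma lim0_plus (u v : nat -> R) :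
  is_lim_seq u 0 -> is_lim_seq v 0 -> is_lim_seq (fun n => (u n + v n)%R) 0.
Proof.
  intros Hu Hv. replace (Finite 0) with (Finite (0 + 0)) by (f_equal; ring).
  now apply is_lim_seq_plus'.
Qed.

Lemma lim0_scal (c : R) (u : nat -> R) :
  is_lim_seq u 0 -> is_lim_seq (fun n => (c * u n)%R) 0.
Proof.
  intros Hu. replace (Finite 0) with (Rbar_mult c 0).
  - now apply is_lim_seq_scal_l.
  - simpl. now rewrite Rmult_0_r.
Qed.

Lemma Clim_const (c : C) : Clim (fun _ => c) c.
Proof.
  apply is_lim_seq_ext with (fun _ => 0%R); [|apply is_lim_seq_const].
  intros n. replace (c - c) with (RtoC 0) by ring. now rewrite Cmod_0.
Qed.

Lemma Clim_ext (u v : nat -> C) (l : C) :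
  (forall n, u n = v n) -> Clim u l -> Clim v l.
Proof. intros H. apply is_lim_seq_ext. intros n. now rewrite H. Qed.

Lemma Clim_plus (u v : nat -> C) (l m : C) :
  Clim u l -> Clim v m -> Clim (fun n => u n + v n) (l + m).
Proof.
  intros Hu Hv.
  apply Clim_dominated with (2 := lim0_plus _ _ Hu Hv). intros n.
  replace (u n + v n - (l + m)) with ((u n - l) + (v n - m)) by ring.
  apply Cmod_triangle.
Qed.

Lemma Clim_mult (u v : nat -> C) (l m : C) :
  Clim u l -> Clim v m -> Clim (fun n => u n * v n) (l * m).
Proof.
  intros Hu Hv.
  assert (Huv : is_lim_seq (fun n => (Cmod (u n - l) * Cmod (v n - m))%R) 0).
  { replace (Finite 0) with (Finite (0 * 0)) by (f_equal; ring).
    now apply is_lim_seq_mult'. }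
  eapply Clim_dominated;
    [|exact (lim0_plus _ _ Huv (lim0_plus _ _ (lim0_scal (Cmod l) _ Hv)
                                          (lim0_scal (Cmod m) _ Hu)))].
  intros n. cbv beta. rewrite <- !Cmod_mult.
  replace (u n * v n - l * m)
    with ((u n - l) * (v n - m) + (l * (v n - m) + m * (u n - l))) by ring.
  eapply Rle_trans; [apply Cmod_triangle|].
  apply Rplus_le_compat_l, Cmod_triangle.
Qed.

Lemma Clim_unique (u : nat -> C) (l m : C) : Clim u l -> Clim u m -> l = m.
Proof.
  intros Hl Hm.
  assert (H : is_lim_seq (fun _ : nat => Cmod (l - m)) 0).
  { apply lim0_squeeze with (2 := lim0_plus _ _ Hl Hm). intros n.
    rewrite Rabs_pos_eq by apply Cmod_ge_0.
    rewrite (Cmod_minus_sym (u n) l).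
    replace (l - m) with ((l - u n) + (u n - m)) by ring. apply Cmod_triangle. }
  apply is_lim_seq_unique in H. rewrite Lim_seq_const in H.
  injection H as H. apply Cmod_eq_0 in H.
  replace l with ((l - m) + m) by ring. rewrite H. ring.
Qed.

Lemma Clim_shift (u : nat -> C) (N : nat) (l : C) :
  Clim u l <-> Clim (fun n => u (n + N)%nat) l.
Proof. apply (is_lim_seq_incr_n (fun n => Cmod (u n - l))). Qed.

Lemma lim0_spec (v : nat -> R) :
  is_lim_seq v 0 <->
  forall eps, (0 < eps)%R -> exists N, forall n, (N <= n)%nat -> (Rabs (v n) < eps)%R.
Proof.
  split.
  - intros H eps He. apply is_lim_seq_spec in H.
    destruct (H (mkposreal eps He)) as [N HN]. exists N. intros n Hn.
    specialize (HN n Hn). simpl in HN. now rewrite Rminus_0_r in HN.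
  - intros H. apply is_lim_seq_spec. intros [eps He].
    destruct (H eps He) as [N HN]. exists N. intros n Hn. simpl.
    rewrite Rminus_0_r. now apply HN.
Qed.

Lemma Clim_spec (u : nat -> C) (l : C) :
  Clim u l <->
  forall eps, (0 < eps)%R -> exists N, forall n, (N <= n)%nat -> (Cmod (u n - l) < eps)%R.
Proof.
  unfold Clim. rewrite lim0_spec.
  split; intros H eps He; destruct (H eps He) as [N HN]; exists N; intros n Hn;
    specialize (HN n Hn); rewrite Rabs_pos_eq in *; auto using Cmod_ge_0.
Qed.

Lemma ball_of_Cmod (l w : C) (eps : R) :
  (Cmod (w - l) < eps)%R -> @ball C_UniformSpace l eps w.
Proof.
  intros H. split.
  - apply Rle_lt_trans with (2 := H). apply (re_le_Cmod (w - l)).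
  - apply Rle_lt_trans with (2 := H). apply (im_le_Cmod (w - l)).
Qed.

Lemma Cmod_of_ball (l w : C) (eps : R) :
  @ball C_UniformSpace l (eps / 2) w -> (Cmod (w - l) < eps)%R.
Proof.
  intros [H1 H2]. eapply Rle_lt_trans; [apply Cmod_le_Re_Im|].
  change (Rabs (Re w - Re l) < eps / 2)%R in H1.
  change (Rabs (Im w - Im l) < eps / 2)%R in H2.
  change (Rabs (Re w - Re l) + Rabs (Im w - Im l) < eps)%R. lra.
Qed.

Lemma Clim_filterlim (u : nat -> C) (l : C) :
  Clim u l <-> filterlim u eventually (@locally C_UniformSpace l).
Proof.
  rewrite Clim_spec. split.
  - intros H. apply (filterlim_locally u). intros [eps He].
    destruct (H eps He) as [N HN]. exists N. intros n Hn.
    apply ball_of_Cmod. simpl. now apply HN.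
  - intros H eps He.
    assert (H2 := proj1 (filterlim_locally u (l : C_UniformSpace)) H).
    assert (He2 : (0 < eps / 2)%R) by lra.
    destruct (H2 (mkposreal _ He2)) as [N HN]. exists N. intros n Hn.
    apply Cmod_of_ball. now apply HN.
Qed.

(** Brings the limits in C x C that normalise the scattering solutions down to
    components. *)
Lemma tends_Clim (u : nat -> C * C) (l : C * C) :
  filterlim u eventually (locally l) <->
  Clim (fun n => fst (u n)) (fst l) /\ Clim (fun n => snd (u n)) (snd l).
Proof.
  rewrite !Clim_filterlim. split.
  - intros H. split.
    + apply filterlim_locally. intros eps.
      destruct (proj1 (filterlim_locally u l) H eps) as [N HN].
      exists N. intros n Hn. apply (HN n Hn).
    + apply filterlim_locally. intros eps.
      destruct (proj1 (filterlim_locally u l) H eps) as [N HN].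
      exists N. intros n Hn. apply (HN n Hn).
  - intros [H1 H2]. apply filterlim_locally. intros eps.
    destruct (proj1 (filterlim_locally _ _) H1 eps) as [N1 HN1].
    destruct (proj1 (filterlim_locally _ _) H2 eps) as [N2 HN2].
    exists (max N1 N2). intros n Hn. split; [apply HN1 | apply HN2]; lia.
Qed.

(** The additive structure is fixed once and for all, since several
    convertible ones are inferred for C. *)
Definition Csum (f : nat -> C) (n : nat) : C :=
  @sum_n (AbelianGroup.AbelianMonoid C_AbelianGroup) f n.

Lemma Csum_0 (f : nat -> C) : Csum f 0 = f 0%nat.
Proof. apply (@sum_O (AbelianGroup.AbelianMonoid C_AbelianGroup)). Qed.

Lemma Csum_S (f : nat -> C) (n : nat) : Csum f (S n) = Csum f n + f (S n).
Proof. apply (@sum_Sn (AbelianGroup.AbelianMonoid C_AbelianGroup)). Qed.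

Lemma is_series_Clim (f : nat -> C) (l : C) :
  Clim (Csum f) l -> is_series (K := C_AbsRing) (V := C_NormedModule) f l.
Proof. intros H. apply Clim_filterlim in H. exact H. Qed.

Lemma Csum_Re (f : nat -> C) (n : nat) : Re (Csum f n) = sum_n (fun i => Re (f i)) n.
Proof.
  induction n; [now rewrite Csum_0, sum_O|].
  rewrite Csum_S, sum_Sn, <- IHn. reflexivity.
Qed.

Lemma Csum_Im (f : nat -> C) (n : nat) : Im (Csum f n) = sum_n (fun i => Im (f i)) n.
Proof.
  induction n; [now rewrite Csum_0, sum_O|].
  rewrite Csum_S, sum_Sn, <- IHn. reflexivity.
Qed.

Lemma lim_squeeze (u v : nat -> R) (l : R) :
  (forall n, Rabs (u n - l) <= v n)%R -> is_lim_seq v 0 -> is_lim_seq u l.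
Proof.
  intros H Hv.
  apply is_lim_seq_ext with (fun n => (l + (u n - l))%R); [intros; ring|].
  replace (Finite l) with (Finite (l + 0)) by (f_equal; ring).
  apply is_lim_seq_plus'; [apply is_lim_seq_const|].
  now apply lim0_squeeze with v.
Qed.

Lemma CSeries_unique (f : nat -> C) (l : C) : Clim (Csum f) l -> CSeries f = l.
Proof.
  intros H. unfold CSeries. rewrite (surjective_pairing l). f_equal.
  - apply is_series_unique.
    change (is_lim_seq (sum_n (fun n => Re (f n))) (Re l)).
    apply is_lim_seq_ext with (fun n => Re (Csum f n)); [apply Csum_Re|].
    apply lim_squeeze with (2 := H). intros n. apply (re_le_Cmod (Csum f n - l)).
  - apply is_series_unique.
    change (is_lim_seq (sum_n (fun n => Im (f n))) (Im l)).
    apply is_lim_seq_ext with (fun n => Im (Csum f n)); [apply Csum_Im|].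
    apply lim_squeeze with (2 := H). intros n. apply (im_le_Cmod (Csum f n - l)).
Qed.

Lemma lim0_of_lim (u : nat -> R) (l : R) :
  is_lim_seq u l -> is_lim_seq (fun n => Rabs (u n - l)) 0.
Proof.
  intros H. apply (proj1 (is_lim_seq_abs_0 (fun n => (u n - l)%R))).
  replace (Finite 0) with (Finite (l - l)) by (f_equal; ring).
  apply is_lim_seq_minus'; auto using is_lim_seq_const.
Qed.

Lemma CSeries_correct (f : nat -> C) :
  ex_series (fun n => Cmod (f n)) -> Clim (Csum f) (CSeries f).
Proof.
  intros H.
  assert (HR : ex_series (fun n => Re (f n))).
  { apply (ex_series_le (K := R_AbsRing) (V := R_CompleteNormedModule))
      with (fun n => Cmod (f n)); auto. intros n. apply re_le_Cmod. }
  assert (HI : ex_series (fun n => Im (f n))).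
  { apply (ex_series_le (K := R_AbsRing) (V := R_CompleteNormedModule))
      with (fun n => Cmod (f n)); auto. intros n. apply im_le_Cmod. }
  apply Series_correct in HR. apply Series_correct in HI.
  apply lim0_of_lim in HR. apply lim0_of_lim in HI.
  apply Clim_dominated with (2 := lim0_plus _ _ HR HI).
  intros n. rewrite <- Csum_Re, <- Csum_Im.
  apply (Cmod_le_Re_Im (Csum f n - CSeries f)).
Qed.

(** * Complex derivatives and branches of the logarithm *)

(** An epsilon-delta form of differentiability, free of the two uniform
    structures (product of two lines, and absolute value) that C carries as a
    module and as a ring of scalars. *)
Definition Cderiv (f : C -> C) (x d : C) : Prop :=
  forall eps, (0 < eps)%R -> exists del, (0 < del)%R /\
    forall y, (Cmod (y - x) < del)%R ->
      (Cmod (f y - f x - (y - x) * d) <= eps * Cmod (y - x))%R.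

Lemma is_derive_Cderiv (f : C -> C) (x d : C) :
  Cderiv f x d -> is_derive (K := C_AbsRing) (V := C_NormedModule) f x d.
Proof.
  intros H. split; [apply (is_linear_scal_l (K := C_AbsRing) (V := C_NormedModule))|].
  intros x' Hx'.
  assert (E : x = x').
  { apply (is_filter_lim_locally_unique (K := C_AbsRing)
             (V := AbsRing_NormedModule C_AbsRing)). exact Hx'. }
  subst x'. intros [eps He].
  destruct (H eps He) as [del [Hd HH]].
  exists (mkposreal del Hd). intros y Hy. apply (HH y). exact Hy.
Qed.

Lemma Cderiv_local (f g : C -> C) (x d : C) (rho : R) :
  (0 < rho)%R -> (forall y, (Cmod (y - x) < rho)%R -> f y = g y) ->
  Cderiv g x d -> Cderiv f x d.
Proof.
  intros Hr Hfg H eps He. destruct (H eps He) as [del [Hd HH]].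
  exists (Rmin rho del). split; [now apply Rmin_glb_lt|].
  intros y Hy.
  assert (H1 := Rmin_l rho del). assert (H2 := Rmin_r rho del).
  rewrite !Hfg; [apply HH; lra| |lra].
  replace (x - x) with (RtoC 0) by ring. now rewrite Cmod_0.
Qed.

Lemma Cderiv_opp_const (f : C -> C) (x d c : C) :
  Cderiv f x d -> Cderiv (fun y => - (f y + c)) x (- d).
Proof.
  intros H eps He. destruct (H eps He) as [del [Hd HH]].
  exists del. split; auto. intros y Hy.
  replace (- (f y + c) - - (f x + c) - (y - x) * - d)
    with (- (f y - f x - (y - x) * d)) by ring.
  rewrite Cmod_opp. now apply HH.
Qed.

(** Every quantity differentiated below is a function of an affine function of
    one potential value, so this instance of the chain rule suffices. *)
Lemma Cderiv_affine_comp (f : C -> C) (c0 c1 x d : C) :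
  Cderiv f (c0 + c1 * x) d -> Cderiv (fun y => f (c0 + c1 * y)) x (c1 * d).
Proof.
  intros H eps He.
  assert (Hc : (0 < Cmod c1 + 1)%R) by (generalize (Cmod_ge_0 c1); lra).
  destruct (H (eps / (Cmod c1 + 1))%R) as [del [Hd HH]].
  { now apply Rdiv_lt_0_compat. }
  exists (del / (Cmod c1 + 1))%R. split; [now apply Rdiv_lt_0_compat|].
  intros y Hy.
  assert (E : c0 + c1 * y - (c0 + c1 * x) = c1 * (y - x)) by ring.
  specialize (HH (c0 + c1 * y)). rewrite E, Cmod_mult in HH.
  replace ((y - x) * (c1 * d)) with (c1 * (y - x) * d) by ring.
  assert (Hm := Cmod_ge_0 c1). assert (Hm2 := Cmod_ge_0 (y - x)).
  assert (Hy' : ((Cmod c1 + 1) * Cmod (y - x) < del)%R).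
  { apply Rmult_lt_compat_l with (r := (Cmod c1 + 1)%R) in Hy; auto.
    replace ((Cmod c1 + 1) * (del / (Cmod c1 + 1)))%R with del in Hy by (field; lra). lra. }
  eapply Rle_trans; [apply HH; nra|].
  replace (eps * Cmod (y - x))%R
    with (eps / (Cmod c1 + 1) * ((Cmod c1 + 1) * Cmod (y - x)))%R by (field; lra).
  apply Rmult_le_compat_l; [left; now apply Rdiv_lt_0_compat|]. nra.
Qed.

Lemma cexp_plus (a b : C) : cexp (a + b) = cexp a * cexp b.
Proof.
  destruct a as [a1 a2], b as [b1 b2]. unfold cexp, Cmult, Cplus; simpl.
  rewrite exp_plus, cos_plus, sin_plus. f_equal; ring.
Qed.

Lemma real_deriv_eps (f : R -> R) (x d : R) : derivable_pt_lim f x d ->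
  forall eps, (0 < eps)%R -> exists del, (0 < del)%R /\ forall h, (Rabs h < del)%R ->
    (Rabs (f (x + h) - f x - d * h) <= eps * Rabs h)%R.
Proof.
  intros H eps He. destruct (H eps He) as [[del Hd] HH]. exists del. split; auto.
  intros h Hh. destruct (Req_dec h 0) as [->|Hh0].
  - rewrite Rplus_0_r. replace (f x - f x - d * 0)%R with 0%R by ring. rewrite Rabs_R0. lra.
  - specialize (HH h Hh0 Hh).
    replace (f (x + h) - f x - d * h)%R with (((f (x + h) - f x) / h - d) * h)%R by (field; auto).
    rewrite Rabs_mult. apply Rmult_le_compat_r; [apply Rabs_pos|lra].
Qed.

(** The derivative of the exponential at 0; it suffices for [log_branch_deriv]
    by the addition formula. *)
Lemma cexp_expansion eps : (0 < eps)%R -> exists del, (0 < del)%R /\ forall h,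
  (Cmod h < del)%R -> (Cmod (cexp h - RtoC 1 - h) <= eps * Cmod h)%R.
Proof.
  intros He.
  assert (He' : (0 < Rmin (eps / 8) (1/2))%R) by (apply Rmin_glb_lt; lra).
  set (e := Rmin (eps / 8) (1/2)) in *.
  assert (e8 : (e <= eps / 8)%R) by apply Rmin_l.
  assert (e2 : (e <= 1/2)%R) by apply Rmin_r. clearbody e.
  destruct (real_deriv_eps _ _ _ (derivable_pt_lim_exp 0) e He') as [d1 [Hd1 H1]].
  destruct (real_deriv_eps _ _ _ (derivable_pt_lim_cos 0) e He') as [d2 [Hd2 H2]].
  destruct (real_deriv_eps _ _ _ (derivable_pt_lim_sin 0) e He') as [d3 [Hd3 H3]].
  rewrite exp_0 in H1. rewrite cos_0, sin_0 in H2. rewrite cos_0, sin_0 in H3.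
  exists (Rmin (Rmin d1 d2) (Rmin d3 e)).
  split; [repeat apply Rmin_glb_lt; auto|].
  intros [x y] Hh.
  assert (Hx := re_le_Cmod (x, y)). assert (Hy := im_le_Cmod (x, y)).
  simpl Re in Hx. simpl Im in Hy.
  set (m := Cmod (x, y)) in *.
  assert (Hm1 := Rmin_l (Rmin d1 d2) (Rmin d3 e)).
  assert (Hm2 := Rmin_r (Rmin d1 d2) (Rmin d3 e)).
  assert (Hm3 := Rmin_l d1 d2). assert (Hm4 := Rmin_r d1 d2).
  assert (Hm5 := Rmin_l d3 e). assert (Hm6 := Rmin_r d3 e).
  specialize (H1 x ltac:(lra)). specialize (H2 y ltac:(lra)). specialize (H3 y ltac:(lra)).
  rewrite !Rplus_0_l in *.
  replace (exp x - 1 - 1 * x)%R with (exp x - 1 - x)%R in H1 by ring.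
  replace (cos y - 1 - - 0 * y)%R with (cos y - 1)%R in H2 by ring.
  replace (sin y - 0 - 1 * y)%R with (sin y - y)%R in H3 by ring.
  assert (Hc : (Rabs (cos y) <= 1)%R) by (apply Rabs_le; apply COS_bound).
  assert (P1 := Rabs_pos x). assert (P2 := Rabs_pos y).
  eapply Rle_trans; [apply Cmod_le_Re_Im|].
  change (Re (cexp (x, y) - RtoC 1 - (x, y))) with (exp x * cos y - 1 - x)%R.
  change (Im (cexp (x, y) - RtoC 1 - (x, y))) with (exp x * sin y - 0 - y)%R.
  replace (exp x * cos y - 1 - x)%R
    with ((exp x - 1 - x) * cos y + (1 + x) * (cos y - 1))%R by ring.
  replace (exp x * sin y - 0 - y)%R
    with ((exp x - 1) * sin y + (sin y - y))%R by ring.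
  assert (B1 : (Rabs ((exp x - 1 - x) * cos y + (1 + x) * (cos y - 1)) <= 3 * e * m)%R).
  { eapply Rle_trans; [apply Rabs_triang|]. rewrite !Rabs_mult.
    assert (Rabs (1 + x) <= 2)%R.
    { eapply Rle_trans; [apply Rabs_triang|]. rewrite Rabs_R1. lra. }
    assert (Q1 := Rabs_pos (exp x - 1 - x)). assert (Q2 := Rabs_pos (cos y - 1)).
    assert (Rabs (exp x - 1 - x) * Rabs (cos y) <= e * m * 1)%R.
    { apply Rmult_le_compat; auto using Rabs_pos. nra. }
    assert (Rabs (1 + x) * Rabs (cos y - 1) <= 2 * (e * m))%R.
    { apply Rmult_le_compat; auto using Rabs_pos. nra. }
    lra. }
  assert (B2 : (Rabs ((exp x - 1) * sin y + (sin y - y)) <= 5 * e * m)%R).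
  { eapply Rle_trans; [apply Rabs_triang|]. rewrite !Rabs_mult.
    assert (S1 : (Rabs (exp x - 1) <= 2 * e)%R).
    { replace (exp x - 1)%R with ((exp x - 1 - x) + x)%R by ring.
      eapply Rle_trans; [apply Rabs_triang|]. nra. }
    assert (S2 : (Rabs (sin y) <= 2 * m)%R).
    { replace (sin y) with ((sin y - y) + y)%R by ring.
      eapply Rle_trans; [apply Rabs_triang|]. nra. }
    assert (Rabs (exp x - 1) * Rabs (sin y) <= 2 * e * (2 * m))%R.
    { apply Rmult_le_compat; auto using Rabs_pos. }
    nra. }
  assert (0 <= m)%R by apply Cmod_ge_0. nra.
Qed.

(** If h = lg w - lg w0, then w - w0 = w0 (cexp h - 1), which is w0 h up to an
    error o(h); continuity of lg makes h small, and solving for h gives the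
    derivative. The point w0 is nonzero because exponentials are invertible. *)
Lemma log_branch_deriv (U : C -> Prop) (lg : C -> C) (w0 : C) :
  log_branch U lg -> U w0 -> w0 <> RtoC 0 /\ Cderiv lg w0 (/ w0).
Proof.
  intros [HoU [Hc He]] HU0.
  assert (Hw0 : w0 <> RtoC 0).
  { intros E. assert (H := He w0 HU0).
    assert (H1 : cexp (lg w0) * cexp (- lg w0) = RtoC 1).
    { rewrite <- cexp_plus. replace (lg w0 + - lg w0) with (RtoC 0) by ring.
      unfold cexp; simpl. rewrite exp_0, cos_0, sin_0. unfold RtoC. f_equal; ring. }
    rewrite H, E in H1. apply C1_nz. rewrite <- H1. ring. }
  split; [exact Hw0|].
  assert (Hp : (0 < Cmod w0)%R) by now apply Cmod_gt_0.
  intros eps Heps.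
  (* e <= 1/2 gives |h| <= 2 |h + rho|; the other bound turns the error
     e |h| into eps |w - w0|. *)
  set (e := Rmin (1/2) (eps * Cmod w0 / 2)).
  assert (Hepos : (0 < e)%R).
  { apply Rmin_glb_lt; [lra|]. apply Rdiv_lt_0_compat; [nra|lra]. }
  assert (el : (e <= 1/2)%R) by apply Rmin_l.
  assert (er : (e <= eps * Cmod w0 / 2)%R) by apply Rmin_r.
  destruct (cexp_expansion e Hepos) as [d [Hd Hexp]].
  destruct (HoU w0 HU0) as [[d1 Hd1] HB].
  assert (Hd2 : (0 < d / 2)%R) by lra.
  destruct (proj1 (filterlim_locally lg (lg w0)) (Hc w0 HU0) (mkposreal _ Hd2)) as [[d2 Hd2'] HC].
  exists (Rmin d1 d2). split; [now apply Rmin_glb_lt|].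
  intros w Hw. assert (M1 := Rmin_l d1 d2). assert (M2 := Rmin_r d1 d2).
  assert (HUw : U w) by (apply HB, ball_of_Cmod; simpl; lra).
  assert (Hh : (Cmod (lg w - lg w0) < d)%R).
  { apply Cmod_of_ball. apply HC, ball_of_Cmod. simpl; lra. }
  set (h := lg w - lg w0) in *.
  assert (Ew : w = w0 * cexp h).
  { rewrite <- (He w HUw), <- (He w0 HU0) at 1. rewrite <- cexp_plus.
    unfold h. f_equal. ring. }
  specialize (Hexp h Hh). set (rho := cexp h - RtoC 1 - h) in *.
  assert (Ediff : (w - w0) * / w0 = h + rho).
  { rewrite Ew. unfold rho. field. exact Hw0. }
  assert (En : Cmod (w - w0) = (Cmod w0 * Cmod (h + rho))%R).
  { rewrite <- Ediff, <- Cmod_mult. f_equal. field. exact Hw0. }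
  rewrite Ediff. replace (h - (h + rho)) with (- rho) by ring. rewrite Cmod_opp.
  assert (T : (Cmod h <= Cmod (h + rho) + Cmod rho)%R).
  { rewrite <- (Cmod_opp rho). replace h with ((h + rho) + - rho) at 1 by ring.
    apply Cmod_triangle. }
  assert (P1 := Cmod_ge_0 h). assert (P2 := Cmod_ge_0 (h + rho)).
  rewrite En.
  assert (Cmod h <= 2 * Cmod (h + rho))%R by nra.
  nra.
Qed.

(** * Summability over the integers *)

Fixpoint wsum (e : Z -> R) (k : Z) (n : nat) : R :=
  match n with
  | O => 0%R
  | S m => (wsum e k m + e (k + Z.of_nat m)%Z)%R
  end.

(** Absolute summability over Z, phrased as a uniform bound on sums over
    finite windows: this form is invariant under shifts and reflections, and
    the bound B controls the constants in all later estimates. *)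
Definition Zsum_le (e : Z -> R) (B : R) : Prop :=
  (forall k, 0 <= e k)%R /\ forall k n, (wsum e k n <= B)%R.

Lemma wsum_add (e : Z -> R) (k : Z) (n m : nat) :
  wsum e k (n + m) = (wsum e k n + wsum e (k + Z.of_nat n) m)%R.
Proof.
  induction m as [|m IH]; simpl.
  - rewrite Nat.add_0_r. ring.
  - rewrite Nat.add_succ_r. simpl. rewrite IH.
    replace (k + Z.of_nat (n + m))%Z with (k + Z.of_nat n + Z.of_nat m)%Z by lia. ring.
Qed.

Lemma wsum_pos (e : Z -> R) (k : Z) (n : nat) :
  (forall j, 0 <= e j)%R -> (0 <= wsum e k n)%R.
Proof.
  intros H. induction n as [|n IH]; simpl; [lra|]. specialize (H (k + Z.of_nat n)%Z). lra.
Qed.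

Lemma wsum_le (e f : Z -> R) (k : Z) (n : nat) :
  (forall j, e j <= f j)%R -> (wsum e k n <= wsum f k n)%R.
Proof.
  intros H. induction n as [|n IH]; simpl; [lra|]. specialize (H (k + Z.of_nat n)%Z). lra.
Qed.

Lemma wsum_linear (a b : R) (e f : Z -> R) (k : Z) (n : nat) :
  wsum (fun j => a * e j + b * f j)%R k n = (a * wsum e k n + b * wsum f k n)%R.
Proof. induction n as [|n IH]; simpl; [ring|]. rewrite IH. ring. Qed.

Lemma wsum_left (e : Z -> R) (k : Z) (n : nat) :
  wsum e k (S n) = (e k + wsum e (k + 1) n)%R.
Proof.
  replace (S n) with (1 + n)%nat by lia. rewrite wsum_add. simpl.
  rewrite Z.add_0_r. ring.
Qed.

Lemma wsum_reflect (e : Z -> R) (k : Z) (n : nat) :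
  wsum (fun j => e (- j - 1)%Z) k n = wsum e (- k - Z.of_nat n)%Z n.
Proof.
  induction n as [|n IH]; [reflexivity|].
  rewrite (wsum_left e). cbn [wsum]. rewrite IH.
  replace (- k - Z.of_nat (S n) + 1)%Z with (- k - Z.of_nat n)%Z by lia.
  replace (- (k + Z.of_nat n) - 1)%Z with (- k - Z.of_nat (S n))%Z by lia. ring.
Qed.

Lemma Zsum_le_reflect (e : Z -> R) (B : R) :
  Zsum_le e B -> Zsum_le (fun j => e (- j - 1)%Z) B.
Proof. intros [H1 H2]. split; auto. intros k n. rewrite wsum_reflect. apply H2. Qed.

Lemma Zsum_le_linear (a b : R) (e f g : Z -> R) (A B : R) :
  (0 <= a)%R -> (0 <= b)%R -> Zsum_le e A -> Zsum_le f B ->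
  (forall j, 0 <= g j <= a * e j + b * f j)%R -> Zsum_le g (a * A + b * B).
Proof.
  intros Ha Hb [_ He] [_ Hf] Hg. split; [intros k; apply Hg|].
  intros k n. eapply Rle_trans; [apply wsum_le; intros j; apply Hg|].
  rewrite wsum_linear. apply Rplus_le_compat; apply Rmult_le_compat_l; auto.
Qed.

Lemma Zsum_le_term (e : Z -> R) (B : R) (k : Z) : Zsum_le e B -> (e k <= B)%R.
Proof.
  intros [_ H]. specialize (H k 1%nat). simpl in H. rewrite Z.add_0_r in H. lra.
Qed.

Lemma Zsum_le_pos (e : Z -> R) (B : R) : Zsum_le e B -> (0 <= B)%R.
Proof. intros H. apply (proj2 H 0%Z 0%nat). Qed.

Lemma sum_n_S (f : nat -> R) (n : nat) : sum_n f (S n) = (sum_n f n + f (S n))%R.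
Proof. apply (sum_Sn (G := R_AbelianMonoid)). Qed.

Lemma sum_n_wsum (e : Z -> R) (k : Z) (n : nat) :
  sum_n (fun i => e (k + Z.of_nat i)%Z) n = wsum e k (S n).
Proof.
  induction n as [|n IH].
  - rewrite sum_O. simpl. ring.
  - rewrite sum_Sn, IH. reflexivity.
Qed.

Lemma ex_series_bounded (f : nat -> R) (B : R) :
  (forall n, 0 <= f n)%R -> (forall n, sum_n f n <= B)%R -> ex_series f.
Proof.
  intros Hf HB. 
  destruct (ex_finite_lim_seq_incr (sum_n f) B) as [l Hl]; auto.
  - intros n. rewrite sum_n_S. specialize (Hf (S n)). lra.
  - exists l. exact Hl.
Qed.

Lemma Zsum_le_ex_series (e : Z -> R) (B : R) (k : Z) :
  Zsum_le e B -> ex_series (fun n => e (k + Z.of_nat n)%Z).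
Proof.
  intros [H1 H2]. apply ex_series_bounded with B; auto.
  intros n. rewrite sum_n_wsum. apply H2.
Qed.

Lemma Zsum_le_lim (e : Z -> R) (B : R) (k : Z) :
  Zsum_le e B -> is_lim_seq (fun n => e (k + Z.of_nat n)%Z) 0.
Proof. intros H. apply ex_series_lim_0. now apply Zsum_le_ex_series with B. Qed.

Lemma Zsum_le_lim_neg (e : Z -> R) (B : R) :
  Zsum_le e B -> is_lim_seq (fun n => e (- Z.of_nat n)%Z) 0.
Proof.
  intros H. apply Zsum_le_reflect in H.
  apply is_lim_seq_ext with (2 := Zsum_le_lim _ _ (-1)%Z H).
  intros n. cbv beta. f_equal. lia.
Qed.

Lemma sum_n_le_Series (f : nat -> R) (n : nat) :
  (forall n, 0 <= f n)%R -> ex_series f -> (sum_n f n <= Series f)%R.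
Proof.
  intros Hf H. apply (is_lim_seq_incr_compare (sum_n f)).
  - apply Series_correct in H. exact H.
  - intros m. rewrite sum_n_S. specialize (Hf (S m)). lra.
Qed.

(** A window around k lies in some [-m, m + n), whose two halves are
    controlled by the two series. *)
Lemma vanishes_Zsum_le (q : Z -> C) :
  vanishes_rapidly q -> exists B, Zsum_le (fun k => Cmod (q k)) B.
Proof.
  intros [H1 H2].
  set (e := fun k => Cmod (q k)).
  assert (He : forall k, (0 <= e k)%R) by (intros; apply Cmod_ge_0).
  exists (Series (fun n => e (- Z.of_nat n)%Z) + Series (fun n => e (Z.of_nat n)))%R.
  split; auto. intros k n.
  assert (Hpos : forall m, (wsum e 0 m <= Series (fun n => e (Z.of_nat n)))%R).
  { intros m. destruct m as [|m].
    - simpl. eapply Rle_trans; [|apply (sum_n_le_Series _ 0); auto].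
      rewrite sum_O. auto.
    - rewrite <- sum_n_wsum. apply sum_n_le_Series; auto. }
  assert (Hneg : forall m, (wsum e (- Z.of_nat m) m <= Series (fun n => e (- Z.of_nat n)%Z))%R).
  { intros m. eapply Rle_trans; [|apply (sum_n_le_Series _ m); auto].
    induction m as [|m IH].
    - simpl. rewrite sum_O. auto.
    - rewrite wsum_left, sum_n_S.
      replace (- Z.of_nat (S m) + 1)%Z with (- Z.of_nat m)%Z by lia.
      lra. }
  set (m := Z.to_nat (Z.abs k)).
  (* The window of length m + (m + n) from -m on, cut at k and at k + n. *)
  assert (E : wsum e (- Z.of_nat m) (m + (m + n)) =
    (wsum e (- Z.of_nat m) (Z.to_nat (k + Z.of_nat m)) + (wsum e k n +
     wsum e (k + Z.of_nat n) (Z.to_nat (Z.of_nat m - k))))%R).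
  { replace (m + (m + n))%nat
      with (Z.to_nat (k + Z.of_nat m) + (n + Z.to_nat (Z.of_nat m - k)))%nat by lia.
    rewrite wsum_add. f_equal.
    replace (- Z.of_nat m + Z.of_nat (Z.to_nat (k + Z.of_nat m)))%Z with k by lia.
    apply wsum_add. }
  rewrite wsum_add in E.
  replace (- Z.of_nat m + Z.of_nat m)%Z with 0%Z in E by lia.
  assert (P1 := wsum_pos e (- Z.of_nat m) (Z.to_nat (k + Z.of_nat m)) He).
  assert (P2 := wsum_pos e (k + Z.of_nat n) (Z.to_nat (Z.of_nat m - k)) He).
  specialize (Hpos (m + n)%nat). specialize (Hneg m). lra.
Qed.

Lemma wsum_single (e : Z -> R) (j k : Z) (n : nat) :
  (forall i, i <> j -> e i = 0%R) -> (0 <= e j)%R -> (wsum e k n <= e j)%R.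
Proof.
  intros He Hj.
  assert (H : ((k + Z.of_nat n <= j)%Z -> wsum e k n = 0%R) /\ (wsum e k n <= e j)%R).
  { induction n as [|n [IH1 IH2]].
    - simpl; split; auto; lra.
    - cbn [wsum]. destruct (Z.eq_dec (k + Z.of_nat n) j) as [E|E].
      + rewrite (IH1 ltac:(lia)), E. split; [lia|lra].
      + rewrite (He _ E). split; [intros; rewrite IH1 by lia; ring|lra]. }
  apply H.
Qed.

(** Changing one value adds one nonnegative term. *)
Lemma Zsum_le_update (q : Z -> C) (B : R) (k : Z) (t : C) :
  Zsum_le (fun j => Cmod (q j)) B ->
  Zsum_le (fun j => Cmod (update q k t j)) (B + Cmod t).
Proof.
  intros H.
  replace (B + Cmod t)%R with (1 * B + 1 * Cmod t)%R by ring.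
  apply Zsum_le_linear with (fun j => Cmod (q j))
    (fun j => if Z.eq_dec j k then Cmod t else 0%R); auto; try lra.
  - split.
    + intros j. destruct (Z.eq_dec j k); [apply Cmod_ge_0|lra].
    + intros j n. eapply Rle_trans; [apply (wsum_single _ k)|].
      * intros i Hi. now destruct (Z.eq_dec i k).
      * destruct (Z.eq_dec k k); [apply Cmod_ge_0|lra].
      * destruct (Z.eq_dec k k); [lra|congruence].
  - intros j. split; [apply Cmod_ge_0|]. unfold update.
    assert (P := Cmod_ge_0 (q j)).
    destruct (Z.eq_dec j k); [|lra]. lra.
Qed.

Lemma finite_bound (f : Z -> R) (N : nat) :
  exists B, forall k, (Z.abs k <= Z.of_nat N)%Z -> (f k <= B)%R.
Proof.
  induction N as [|N [B HB]].
  - exists (f 0%Z). intros k Hk. replace k with 0%Z by lia. lra.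
  - exists (Rmax B (Rmax (f (Z.of_nat (S N))) (f (- Z.of_nat (S N))%Z))).
    intros k Hk. destruct (Z_le_gt_dec (Z.abs k) (Z.of_nat N)) as [H|H].
    + eapply Rle_trans; [now apply HB|apply Rmax_l].
    + eapply Rle_trans; [|apply Rmax_r].
      destruct (Z_le_gt_dec 0 k).
      * replace k with (Z.of_nat (S N)) by lia. apply Rmax_l.
      * replace k with (- Z.of_nat (S N))%Z by lia. apply Rmax_r.
Qed.

Lemma Zsum_le_small (e : Z -> R) (B eps : R) : Zsum_le e B -> (0 < eps)%R ->
  exists N : nat, forall k, (Z.of_nat N < Z.abs k)%Z -> (e k < eps)%R.
Proof.
  intros H He.
  destruct (proj1 (lim0_spec _) (Zsum_le_lim _ _ 0%Z H) eps He) as [N1 H1].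
  destruct (proj1 (lim0_spec _) (Zsum_le_lim_neg _ _ H) eps He) as [N2 H2].
  exists (max N1 N2). intros k Hk.
  destruct (Z_le_gt_dec 0 k).
  - specialize (H1 (Z.to_nat k) ltac:(lia)).
    replace (0 + Z.of_nat (Z.to_nat k))%Z with k in H1 by lia.
    apply Rle_lt_trans with (2 := H1). apply Rle_abs.
  - specialize (H2 (Z.to_nat (- k)) ltac:(lia)).
    replace (- Z.of_nat (Z.to_nat (- k)))%Z with k in H2 by lia.
    apply Rle_lt_trans with (2 := H2). apply Rle_abs.
Qed.

(** Outside a finite set |x_k| < 1/2, and finitely many values are bounded. *)
Lemma inv_one_minus_bounded (x : Z -> C) (B : R) :
  Zsum_le (fun k => Cmod (x k)) B -> (forall k, RtoC 1 - x k <> RtoC 0) ->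
  exists c, (1 <= c)%R /\ forall k, (Cmod (/ (RtoC 1 - x k)) <= c)%R.
Proof.
  intros H Hx.
  destruct (Zsum_le_small _ _ (1/2) H ltac:(lra)) as [N HN].
  destruct (finite_bound (fun k => Cmod (/ (RtoC 1 - x k))) N) as [b Hb].
  exists (Rmax 2 b). split; [eapply Rle_trans; [|apply Rmax_l]; lra|].
  intros k. destruct (Z_le_gt_dec (Z.abs k) (Z.of_nat N)) as [Hk|Hk].
  - eapply Rle_trans; [now apply Hb|apply Rmax_r].
  - eapply Rle_trans; [|apply Rmax_l]. specialize (HN k ltac:(lia)).
    rewrite Cmod_inv by apply Hx.
    assert (1 <= Cmod (RtoC 1 - x k) + Cmod (x k))%R.
    { generalize (Cmod_triangle (RtoC 1 - x k) (x k)).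
      replace (RtoC 1 - x k + x k) with (RtoC 1) by ring. now rewrite Cmod_1. }
    replace 2%R with (/ (1/2))%R by field. apply Rinv_le_contravar; lra.
Qed.

(** * Solutions of linear recursions with prescribed limit at infinity *)

Record mat := Mat { m11 : C; m12 : C; m21 : C; m22 : C }.

Definition mv (m : mat) (x : C * C) : C * C :=
  (m11 m * fst x + m12 m * snd x, m21 m * fst x + m22 m * snd x).

Definition trmat (m : mat) : mat := Mat (m11 m) (m21 m) (m12 m) (m22 m).

Definition dot (x y : C * C) : C := fst x * fst y + snd x * snd y.

Definition vnorm (x : C * C) : R := (Cmod (fst x) + Cmod (snd x))%R.

Definition e1 : C * C := (RtoC 1, RtoC 0).

Definition vdist (x y : C * C) : R := (Cmod (fst x - fst y) + Cmod (snd x - snd y))%R.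

(** In the norm |x1| + |x2| the matrix moves e1 by at most e and expands
    lengths by a factor of at most 1 + e. The entry m22 may have modulus up to
    1, which allows for z^{-2}. *)
Definition near_id (e : R) (m : mat) : Prop :=
  (Cmod (m11 m - RtoC 1) + Cmod (m21 m) <= e /\ Cmod (m12 m) + Cmod (m22 m) <= 1 + e)%R.

(** The recursion runs towards smaller k, so that the condition at +oo
    determines the solution. *)
Definition is_jost (N : Z -> mat) (y : Z -> C * C) : Prop :=
  (forall k, y k = mv (N k) (y (k + 1)%Z)) /\
  is_lim_seq (fun n => vdist (y (Z.of_nat n)) e1) 0.

Lemma vnorm_pos (x : C * C) : (0 <= vnorm x)%R.
Proof. unfold vnorm. generalize (Cmod_ge_0 (fst x)) (Cmod_ge_0 (snd x)). lra. Qed.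

Lemma vdist_pos (x y : C * C) : (0 <= vdist x y)%R.
Proof. apply (vnorm_pos (fst x - fst y, snd x - snd y)). Qed.

Lemma vdist_triangle (x y w : C * C) : (vdist x w <= vdist x y + vdist y w)%R.
Proof.
  unfold vdist.
  replace (fst x - fst w) with ((fst x - fst y) + (fst y - fst w)) by ring.
  replace (snd x - snd w) with ((snd x - snd y) + (snd y - snd w)) by ring.
  generalize (Cmod_triangle (fst x - fst y) (fst y - fst w))
    (Cmod_triangle (snd x - snd y) (snd y - snd w)). lra.
Qed.

Lemma vdist_sym (x y : C * C) : vdist x y = vdist y x.
Proof. unfold vdist. now rewrite Cmod_minus_sym, (Cmod_minus_sym (snd x)). Qed.

Lemma vnorm_e1 : vnorm e1 = 1%R.
Proof. unfold vnorm, e1; simpl. rewrite Cmod_1, Cmod_0. ring. Qed.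

Lemma vdist_0 (x : C * C) : vdist x (RtoC 0, RtoC 0) = vnorm x.
Proof. unfold vdist, vnorm; simpl. f_equal; f_equal; ring. Qed.

Lemma vdist_mv (e : R) (m : mat) (x y : C * C) : near_id e m ->
  (vdist (mv m x) (mv m y) <= (1 + e) * vdist x y)%R.
Proof.
  intros [H1 H2].
  assert (H3 : (Cmod (m11 m) <= 1 + Cmod (m11 m - RtoC 1))%R).
  { generalize (Cmod_triangle (RtoC 1) (m11 m - RtoC 1)).
    replace (RtoC 1 + (m11 m - RtoC 1)) with (m11 m) by ring. now rewrite Cmod_1. }
  unfold vdist, mv; simpl.
  set (a := fst x - fst y). set (b := snd x - snd y).
  replace (m11 m * fst x + m12 m * snd x - (m11 m * fst y + m12 m * snd y))
    with (m11 m * a + m12 m * b) by (unfold a, b; ring).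
  replace (m21 m * fst x + m22 m * snd x - (m21 m * fst y + m22 m * snd y))
    with (m21 m * a + m22 m * b) by (unfold a, b; ring).
  generalize (Cmod_triangle (m11 m * a) (m12 m * b)) (Cmod_triangle (m21 m * a) (m22 m * b)).
  rewrite !Cmod_mult. generalize (Cmod_ge_0 a) (Cmod_ge_0 b). nra.
Qed.

Lemma vdist_mv_e1 (e : R) (m : mat) : near_id e m -> (vdist (mv m e1) e1 <= e)%R.
Proof.
  intros [H1 _]. unfold vdist, mv, e1; simpl.
  replace (m11 m * RtoC 1 + m12 m * RtoC 0 - RtoC 1) with (m11 m - RtoC 1) by ring.
  replace (m21 m * RtoC 1 + m22 m * RtoC 0 - RtoC 0) with (m21 m) by ring. exact H1.
Qed.

(** Factors are appended at the right end, so that the products converge as n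
    grows; [transport_left] gives the recursion at the left end. *)
Fixpoint transport (N : Z -> mat) (k : Z) (n : nat) (v : C * C) : C * C :=
  match n with
  | O => v
  | S m => transport N k m (mv (N (k + Z.of_nat m)%Z) v)
  end.

Lemma transport_left (N : Z -> mat) (k : Z) (n : nat) (v : C * C) :
  transport N k (S n) v = mv (N k) (transport N (k + 1) n v).
Proof.
  revert v. induction n as [|n IH]; intros v.
  - simpl. now rewrite Z.add_0_r.
  - cbn [transport] in IH |- *. rewrite IH.
    now replace (k + 1 + Z.of_nat n)%Z with (k + Z.of_nat (S n))%Z by lia.
Qed.

Lemma exp_wsum_step (e x : R) : (0 <= e)%R -> (exp x * (1 + e) <= exp (x + e))%R.
Proof.
  intros He. rewrite exp_plus. apply Rmult_le_compat_l; [left; apply exp_pos|].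
  destruct He as [He|<-]; [left; now apply exp_ineq1; lra|rewrite exp_0; lra].
Qed.

(** Each factor expands by at most 1 + e_j <= exp e_j. *)
Lemma transport_lipschitz (e : Z -> R) (N : Z -> mat) (k : Z) (n : nat) (v w : C * C) :
  (forall j, 0 <= e j)%R -> (forall j, near_id (e j) (N j)) ->
  (vdist (transport N k n v) (transport N k n w) <= exp (wsum e k n) * vdist v w)%R.
Proof.
  intros He HN. revert v w. induction n as [|n IH]; intros v w.
  - simpl. rewrite exp_0. lra.
  - cbn [transport wsum]. eapply Rle_trans; [apply IH|].
    eapply Rle_trans; [apply Rmult_le_compat_l; [left; apply exp_pos|apply vdist_mv, HN]|].
    rewrite <- Rmult_assoc. apply Rmult_le_compat_r; [apply vdist_pos|].
    now apply exp_wsum_step.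
Qed.

Lemma exp_wsum_le (e : Z -> R) (B : R) (HB : Zsum_le e B) (k : Z) (n : nat) :
  (exp (wsum e k n) <= exp B)%R.
Proof.
  destruct (proj2 HB k n) as [H|H]; [left; now apply exp_increasing|rewrite H; lra].
Qed.

(** One more factor changes e1 by at most e_j, and the factors on the left
    expand this change by at most exp B. Summability of e then gives
    convergence of the products. *)
Lemma transport_step (e : Z -> R) (B : R) (N : Z -> mat) (HB : Zsum_le e B)
  (HN : forall j, near_id (e j) (N j)) (k : Z) (n : nat) :
  (vdist (transport N k (S n) e1) (transport N k n e1) <= exp B * e (k + Z.of_nat n)%Z)%R.
Proof.
  cbn [transport].
  eapply Rle_trans; [exact (transport_lipschitz e N k n _ _ (proj1 HB) HN)|].
  apply Rmult_le_compat; auto using vdist_pos, exp_wsum_le.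
  - left; apply exp_pos.
  - now apply vdist_mv_e1.
Qed.

Lemma transport_e1 (e : Z -> R) (B : R) (N : Z -> mat) (HB : Zsum_le e B)
  (HN : forall j, near_id (e j) (N j)) (k : Z) (n : nat) :
  (vdist (transport N k n e1) e1 <= exp B * wsum e k n)%R.
Proof.
  induction n as [|n IH].
  - simpl. unfold vdist. replace (fst e1 - fst e1) with (RtoC 0) by ring.
    replace (snd e1 - snd e1) with (RtoC 0) by ring. rewrite Cmod_0. lra.
  - eapply Rle_trans; [apply (vdist_triangle _ (transport N k n e1))|].
    generalize (transport_step e B N HB HN k n). cbn [wsum]. lra.
Qed.

Lemma vnorm_transport_e1 (e : Z -> R) (B : R) (N : Z -> mat) (HB : Zsum_le e B)
  (HN : forall j, near_id (e j) (N j)) (k : Z) (n : nat) : (vnorm (transport N k n e1) <= exp B)%R.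
Proof.
  assert (H := transport_lipschitz e N k n e1 (RtoC 0, RtoC 0) (proj1 HB) HN).
  assert (Z0 : transport N k n (RtoC 0, RtoC 0) = (RtoC 0, RtoC 0)).
  { clear. induction n as [|n IH]; simpl; auto.
    transitivity (transport N k n (RtoC 0, RtoC 0)); auto.
    f_equal. unfold mv; simpl. f_equal; ring. }
  rewrite Z0 in H.
  rewrite !vdist_0, vnorm_e1, Rmult_1_r in H. eapply Rle_trans; [exact H|now apply exp_wsum_le].
Qed.

Lemma Clim_of_steps (u : nat -> C) (f : nat -> R) :
  (forall n, Cmod (u (S n) - u n) <= f n)%R -> ex_series f -> exists l, Clim u l.
Proof.
  intros H Hf.
  assert (Hd : ex_series (fun n => Cmod (u (S n) - u n))).
  { apply (ex_series_le (K := R_AbsRing) (V := R_CompleteNormedModule)) with f; auto.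
    intros n. unfold norm; simpl. unfold abs; simpl.
    rewrite Rabs_pos_eq; auto using Cmod_ge_0. }
  apply (CSeries_correct (fun n => u (S n) - u n)) in Hd.
  exists (u 0%nat + CSeries (fun n => u (S n) - u n)).
  apply (Clim_shift u 1).
  apply Clim_ext with (2 := Clim_plus _ _ _ _ (Clim_const (u 0%nat)) Hd).
  intros n. rewrite Nat.add_1_r. induction n as [|n IH].
  - rewrite Csum_0. ring.
  - rewrite Csum_S, Cplus_assoc, IH. ring.
Qed.

Lemma vdist_lim (u : nat -> C * C) (l : C * C) :
  is_lim_seq (fun n => vdist (u n) l) 0 <->
  Clim (fun n => fst (u n)) (fst l) /\ Clim (fun n => snd (u n)) (snd l).
Proof.
  split.
  - intros H. split; apply Clim_dominated with (2 := H); intros n; unfold vdist.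
    + generalize (Cmod_ge_0 (snd (u n) - snd l)). lra.
    + generalize (Cmod_ge_0 (fst (u n) - fst l)). lra.
  - intros [H1 H2]. exact (lim0_plus _ _ H1 H2).
Qed.

(** Closed balls are stable under limits. *)
Lemma vdist_le_lim (u : nat -> C * C) (l w : C * C) (c : R) :
  Clim (fun n => fst (u n)) (fst l) -> Clim (fun n => snd (u n)) (snd l) ->
  (forall n, vdist (u n) w <= c)%R -> (vdist l w <= c)%R.
Proof.
  intros H1 H2 H.
  assert (L := lim0_plus _ _ H1 H2).
  assert (L' : is_lim_seq (fun n => (vdist l (u n) + c)%R) (0 + c)%R).
  { apply is_lim_seq_plus'; [|apply is_lim_seq_const].
    apply is_lim_seq_ext with (2 := L). intros n. now rewrite vdist_sym. }
  rewrite Rplus_0_l in L'.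
  refine (is_lim_seq_le (fun _ => vdist l w) _ _ c _ (is_lim_seq_const _) L').
  intros n. eapply Rle_trans; [apply (vdist_triangle _ (u n))|]. specialize (H n). lra.
Qed.

(** The solution is y_k = lim_n N_k ... N_{k+n-1} e1. Its distance from e1 is
    bounded by exp B times the tail of the sum of e from k on, whence the
    limit at +oo. *)
Lemma jost_exists (e : Z -> R) (B : R) (N : Z -> mat) (HB : Zsum_le e B)
  (HN : forall j, near_id (e j) (N j)) : exists y, is_jost N y /\ forall k, (vnorm (y k) <= exp B)%R.
Proof.
  assert (HT : forall k, exists l : C * C,
    Clim (fun n => fst (transport N k n e1)) (fst l) /\
    Clim (fun n => snd (transport N k n e1)) (snd l)).
  { intros k.
    assert (Hex : ex_series (fun n => (exp B * e (k + Z.of_nat n)%Z)%R)).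
    { apply (ex_series_scal (K := R_AbsRing) (V := R_NormedModule)).
      now apply Zsum_le_ex_series with B. }
    destruct (fun H => Clim_of_steps (fun n => fst (transport N k n e1)) _ H Hex) as [l1 H1].
    { intros n. eapply Rle_trans; [|exact (transport_step e B N HB HN k n)]. unfold vdist.
      generalize (Cmod_ge_0 (snd (transport N k (S n) e1) - snd (transport N k n e1))). lra. }
    destruct (fun H => Clim_of_steps (fun n => snd (transport N k n e1)) _ H Hex) as [l2 H2].
    { intros n. eapply Rle_trans; [|exact (transport_step e B N HB HN k n)]. unfold vdist.
      generalize (Cmod_ge_0 (fst (transport N k (S n) e1) - fst (transport N k n e1))). lra. }
    now exists (l1, l2). }
  apply functional_choice in HT. destruct HT as [y Hy].
  exists y. split; [split|].
  - intros k. destruct (Hy k) as [F1 F2]. destruct (Hy (k + 1)%Z) as [G1 G2].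
    apply (Clim_shift _ 1) in F1. apply (Clim_shift _ 1) in F2.
    rewrite (surjective_pairing (y k)). unfold mv. f_equal.
    + apply Clim_unique with (1 := F1).
      apply Clim_ext with (2 := Clim_plus _ _ _ _
        (Clim_mult _ _ _ _ (Clim_const (m11 (N k))) G1)
        (Clim_mult _ _ _ _ (Clim_const (m12 (N k))) G2)).
      intros n. now rewrite Nat.add_1_r, transport_left.
    + apply Clim_unique with (1 := F2).
      apply Clim_ext with (2 := Clim_plus _ _ _ _
        (Clim_mult _ _ _ _ (Clim_const (m21 (N k))) G1)
        (Clim_mult _ _ _ _ (Clim_const (m22 (N k))) G2)).
      intros n. now rewrite Nat.add_1_r, transport_left.
  - destruct (Zsum_le_ex_series e B 0 HB) as [s Hs].
    assert (Hw : is_lim_seq (fun n => wsum e 0 n) s).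
    { apply is_lim_seq_incr_1.
      apply is_lim_seq_ext with (2 := Hs). apply sum_n_wsum. }
    assert (Hincr : forall n, (wsum e 0 n <= s)%R).
    { intros n. apply (is_lim_seq_incr_compare (wsum e 0)); auto.
      intros m. cbn [wsum]. generalize (proj1 HB (0 + Z.of_nat m)%Z). lra. }
    assert (Htail : is_lim_seq (fun n => (exp B * (s - wsum e 0 n))%R) 0).
    { apply lim0_scal. replace (Finite 0) with (Finite (s - s)) by (f_equal; ring).
      apply is_lim_seq_minus'; auto using is_lim_seq_const. }
    apply lim0_squeeze with (2 := Htail). intros k.
    rewrite Rabs_pos_eq by apply vdist_pos.
    destruct (Hy (Z.of_nat k)) as [F1 F2].
    apply (vdist_le_lim _ _ _ _ F1 F2). intros n.
    eapply Rle_trans; [exact (transport_e1 e B N HB HN _ n)|].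
    apply Rmult_le_compat_l; [left; apply exp_pos|].
    specialize (Hincr (k + n)%nat). rewrite wsum_add in Hincr. rewrite Z.add_0_l in Hincr. lra.
  - intros k. destruct (Hy k) as [F1 F2].
    rewrite <- vdist_0. apply (vdist_le_lim _ _ _ _ F1 F2). intros n. rewrite vdist_0.
    exact (vnorm_transport_e1 e B N HB HN k n).
Qed.

Lemma transport_solution (N : Z -> mat) (y : Z -> C * C) (k0 : Z) (n : nat) :
  (forall k, (k0 <= k)%Z -> y k = mv (N k) (y (k + 1)%Z)) ->
  y k0 = transport N k0 n (y (k0 + Z.of_nat n)%Z).
Proof.
  intros H. induction n as [|n IH].
  - simpl. now rewrite Z.add_0_r.
  - cbn [transport]. rewrite IH. f_equal. rewrite H by lia. do 2 f_equal. lia.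
Qed.

(** Two solutions on a half line agree because their difference at k0 is at
    most exp B times their difference far out. Only the coefficients from k0
    on matter, which makes Jost solutions insensitive to changes of the
    potentials elsewhere. *)
Lemma jost_unique (e : Z -> R) (B : R) (N : Z -> mat) (HB : Zsum_le e B)
  (HN : forall j, near_id (e j) (N j)) (y y' : Z -> C * C) (k0 : Z) :
  (forall k, (k0 <= k)%Z -> y k = mv (N k) (y (k + 1)%Z)) ->
  (forall k, (k0 <= k)%Z -> y' k = mv (N k) (y' (k + 1)%Z)) ->
  is_lim_seq (fun n => vdist (y (Z.of_nat n)) e1) 0 ->
  is_lim_seq (fun n => vdist (y' (Z.of_nat n)) e1) 0 ->
  y k0 = y' k0.
Proof.
  intros H H' L L'.
  assert (LL := lim0_scal (exp B) _ (lim0_plus _ _ L L')).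
  apply (is_lim_seq_incr_n _ (Z.to_nat k0)) in LL.
  assert (D : is_lim_seq (fun _ : nat => vdist (y k0) (y' k0)) 0).
  { apply lim0_squeeze with (2 := LL). intros n.
    rewrite Rabs_pos_eq by apply vdist_pos.
    set (m := (n + Z.to_nat k0)%nat).
    set (d := Z.to_nat (Z.of_nat m - k0)).
    rewrite (transport_solution N y k0 d H), (transport_solution N y' k0 d H').
    replace (k0 + Z.of_nat d)%Z with (Z.of_nat m) by (unfold d, m; lia).
    eapply Rle_trans; [exact (transport_lipschitz e N k0 d _ _ (proj1 HB) HN)|].
    apply Rmult_le_compat; auto using vdist_pos, exp_wsum_le.
    - left; apply exp_pos.
    - rewrite (vdist_sym (y' _)). apply vdist_triangle. }
  apply is_lim_seq_unique in D. rewrite Lim_seq_const in D. injection D as D.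
  unfold vdist in D.
  assert (P1 := Cmod_ge_0 (fst (y k0) - fst (y' k0))).
  assert (P2 := Cmod_ge_0 (snd (y k0) - snd (y' k0))).
  assert (D1 : fst (y k0) - fst (y' k0) = RtoC 0) by (apply Cmod_eq_0; lra).
  assert (D2 : snd (y k0) - snd (y' k0) = RtoC 0) by (apply Cmod_eq_0; lra).
  rewrite (surjective_pairing (y k0)), (surjective_pairing (y' k0)). f_equal.
  - replace (fst (y k0)) with (fst (y k0) - fst (y' k0) + fst (y' k0)) by ring.
    rewrite D1. ring.
  - replace (snd (y k0)) with (snd (y k0) - snd (y' k0) + snd (y' k0)) by ring.
    rewrite D2. ring.
Qed.

Lemma jost_bound (e : Z -> R) (B : R) (N : Z -> mat) (HB : Zsum_le e B)
  (HN : forall j, near_id (e j) (N j)) (y : Z -> C * C) (k : Z) :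
  is_jost N y -> (vnorm (y k) <= exp B)%R.
Proof.
  intros [H1 H2]. destruct (jost_exists e B N HB HN) as [y' [[H1' H2'] Hb]].
  rewrite (jost_unique e B N HB HN y y' k); auto.
Qed.

(** * Jost solutions of the discrete Zakharov--Shabat problem *)

Lemma zpow_nat (z : C) (n : nat) : zpow z (Z.of_nat n) = Cpow z n.
Proof. destruct n; [reflexivity|]. simpl zpow. now rewrite SuccNat2Pos.id_succ. Qed.

Lemma zpow_neg (z : C) (k : Z) : z <> RtoC 0 -> zpow z (- k) = / zpow z k.
Proof.
  intros Hz. destruct k as [|p|p]; simpl.
  - field. 
  - reflexivity.
  - field. now apply Cpow_nz.
Qed.

Lemma zpow_nz (z : C) (k : Z) : z <> RtoC 0 -> zpow z k <> RtoC 0.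
Proof.
  intros Hz. destruct k as [|p|p]; simpl.
  - apply C1_nz.
  - now apply Cpow_nz.
  - intros E. apply C1_nz.
    rewrite <- (Cinv_r (Cpow z (Pos.to_nat p))) by now apply Cpow_nz. rewrite E. ring.
Qed.

Lemma zpow_succ (z : C) (k : Z) : z <> RtoC 0 -> zpow z (k + 1) = z * zpow z k.
Proof.
  intros Hz. destruct (Z_le_gt_dec 0 k) as [H|H].
  - replace (k + 1)%Z with (Z.of_nat (S (Z.to_nat k))) by lia.
    replace k with (Z.of_nat (Z.to_nat k)) at 2 by lia.
    now rewrite !zpow_nat, Cpow_S.
  - replace (k + 1)%Z with (- Z.of_nat (Z.to_nat (- k - 1)))%Z by lia.
    replace k with (- Z.of_nat (S (Z.to_nat (- k - 1))))%Z at 2 by lia.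
    rewrite !zpow_neg, !zpow_nat, Cpow_S by auto. field.
    split; auto. now apply Cpow_nz.
Qed.

(** The transfer matrix after removing the factor z^k: if nu_k = z^k X_k
    solves the scattering problem, then X_{k+1} = M_k X_k. *)
Definition tm (q r : Z -> C) (z : C) (k : Z) : mat :=
  Mat (RtoC 1) (q k / z) (r k / z) (/ (z * z)).

Definition left_jost (q r : Z -> C) (z : C) (X : Z -> C * C) : Prop :=
  (forall k, X (k + 1)%Z = mv (tm q r z k) (X k)) /\
  is_lim_seq (fun n => vdist (X (- Z.of_nat n)%Z) e1) 0.

(** Row vector solutions l_k = l_{k+1} M_k, written with the transposed
    matrix. Pairing with such an l amounts to the Wronskian with psi, up to a
    factor that depends on k only. *)
Definition right_jost (q r : Z -> C) (z : C) (l : Z -> C * C) : Prop :=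
  is_jost (fun k => trmat (tm q r z k)) l.

Definition pot_le (q r : Z -> C) (S : R) : Prop :=
  Zsum_le (fun k => Cmod (q k) + Cmod (r k))%R S.

Lemma Cmod_ge_1_nz (z : C) : (1 <= Cmod z)%R -> z <> RtoC 0.
Proof. intros H E. rewrite E, Cmod_0 in H. lra. Qed.

Lemma Cmod_div_le (x z : C) : (1 <= Cmod z)%R -> (Cmod (x / z) <= Cmod x)%R.
Proof.
  intros H. rewrite Cmod_div by now apply Cmod_ge_1_nz.
  apply Rmult_le_reg_r with (Cmod z); [lra|]. unfold Rdiv.
  rewrite Rmult_assoc, Rinv_l by lra. generalize (Cmod_ge_0 x). nra.
Qed.

Lemma Cmod_inv_sq_le (z : C) : (1 <= Cmod z)%R -> (Cmod (/ (z * z)) <= 1)%R.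
Proof.
  intros H. assert (Hz := Cmod_ge_1_nz z H).
  rewrite Cmod_inv, Cmod_mult by now apply Cmult_neq_0.
  rewrite <- Rinv_1. apply Rinv_le_contravar; nra.
Qed.

Lemma tm_near_id (q r : Z -> C) (z : C) (k : Z) : (1 <= Cmod z)%R ->
  near_id (Cmod (q k) + Cmod (r k)) (tm q r z k) /\
  near_id (Cmod (q k) + Cmod (r k)) (trmat (tm q r z k)).
Proof.
  intros H. unfold near_id, trmat, tm; simpl.
  replace (RtoC 1 - RtoC 1) with (RtoC 0) by ring. rewrite Cmod_0.
  generalize (Cmod_div_le (q k) z H) (Cmod_div_le (r k) z H) (Cmod_inv_sq_le z H)
   (Cmod_ge_0 (q k)) (Cmod_ge_0 (r k)). lra.
Qed.

(** The reflection k -> -k turns the condition at -oo into one at +oo. *)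
Lemma left_jost_is_jost (q r : Z -> C) (z : C) (X : Z -> C * C) :
  left_jost q r z X <-> is_jost (fun k => tm q r z (- k - 1)) (fun k => X (- k)%Z).
Proof.
  unfold left_jost, is_jost. split; intros [H1 H2]; split; auto.
  - intros k. rewrite <- (Z.sub_add 1 (- k)) at 1. rewrite H1. do 2 f_equal. lia.
  - intros k. specialize (H1 (- k - 1)%Z).
    replace (- (- k - 1))%Z with (k + 1)%Z in H1 by lia. rewrite H1. f_equal; f_equal; lia.
Qed.

Lemma jost_solutions (q r : Z -> C) (z : C) (S : R) :
  pot_le q r S -> (1 <= Cmod z)%R ->
  exists X l, left_jost q r z X /\ right_jost q r z l.
Proof.
  intros HS Hz.
  destruct (jost_exists _ S _ (Zsum_le_reflect _ _ HS)
    (fun k => proj1 (tm_near_id q r z (- k - 1) Hz))) as [Y [HY _]].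
  destruct (jost_exists _ S _ HS (fun k => proj2 (tm_near_id q r z k Hz))) as [l [Hl _]].
  exists (fun k => Y (- k)%Z), l. split; auto.
  apply left_jost_is_jost.
  replace (fun k => Y (- - k)%Z) with Y; auto.
  apply functional_extensionality. intros k. now rewrite Z.opp_involutive.
Qed.

Lemma Z_const (f : Z -> C) (j k : Z) : (forall i, f (i + 1)%Z = f i) -> f k = f j.
Proof.
  intros H.
  assert (H0 : forall i, f i = f 0%Z).
  { intros i. induction i using Z.peano_ind; auto.
    - now rewrite <- Z.add_1_r, H.
    - rewrite <- IHi. rewrite <- (H (Z.pred i)). f_equal. lia. }
  now rewrite !H0, (H0 j).
Qed.

Lemma dot_trmat (m : mat) (l x : C * C) : dot (mv (trmat m) l) x = dot l (mv m x).
Proof. unfold dot, mv, trmat; simpl. ring. Qed.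

Lemma dot_const (q r : Z -> C) (z : C) (X l : Z -> C * C) (j k : Z) :
  left_jost q r z X -> right_jost q r z l -> dot (l k) (X k) = dot (l j) (X j).
Proof.
  intros HX Hl. apply (Z_const (fun i => dot (l i) (X i))). intros i.
  now rewrite (proj1 HX), <- dot_trmat, <- (proj1 Hl).
Qed.

(** Since l tends to e1 and X is bounded, X^1_n - l_n X_n tends to 0, and l_n
    X_n is constant. *)
Lemma left_jost_fst_lim (q r : Z -> C) (z : C) (X l : Z -> C * C) (K : R) :
  left_jost q r z X -> right_jost q r z l -> (forall k, vnorm (X k) <= K)%R ->
  Clim (fun n => fst (X (Z.of_nat n))) (dot (l 0%Z) (X 0%Z)).
Proof.
  intros HX Hl HK. apply Clim_dominated with (2 := lim0_scal K _ (proj2 Hl)). intros n.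
  rewrite (dot_const q r z X l (Z.of_nat n) 0 HX Hl). specialize (HK (Z.of_nat n)).
  set (x := X (Z.of_nat n)) in *. set (y := l (Z.of_nat n)).
  unfold dot, vdist, vnorm, e1 in *; simpl.
  replace (fst x - (fst y * fst x + snd y * snd x))
    with (- ((fst y - RtoC 1) * fst x + (snd y - RtoC 0) * snd x)) by ring.
  rewrite Cmod_opp. eapply Rle_trans; [apply Cmod_triangle|]. rewrite !Cmod_mult.
  generalize (Cmod_ge_0 (fst x)) (Cmod_ge_0 (snd x)) (Cmod_ge_0 (fst y - RtoC 1))
    (Cmod_ge_0 (snd y - RtoC 0)). nra.
Qed.

(** Summing the inequality bounds the partial sums of y by (y_0 + E) / (1 -
    th). *)
Lemma lim0_contraction (y eps : nat -> R) (th E : R) :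
  (0 <= th < 1)%R -> (forall n, 0 <= y n)%R -> (forall n, sum_n eps n <= E)%R ->
  (forall n, y (S n) <= th * y n + eps n)%R -> is_lim_seq y 0.
Proof.
  intros Hth Hy HE H. apply ex_series_lim_0.
  apply ex_series_bounded with ((y 0%nat + E) / (1 - th))%R; auto.
  assert (P : forall n, (sum_n y (S n) <= y 0%nat + th * sum_n y n + sum_n eps n)%R).
  { induction n as [|n IH].
    - rewrite sum_n_S, !sum_O. specialize (H 0%nat). lra.
    - rewrite sum_n_S, (sum_n_S y n), (sum_n_S eps n). specialize (H (S n)).
      rewrite sum_n_S in IH. lra. }
  intros n. apply Rmult_le_reg_r with (1 - th)%R; [lra|].
  unfold Rdiv. rewrite Rmult_assoc, Rinv_l, Rmult_1_r by lra.
  specialize (P n). rewrite sum_n_S in P. specialize (Hy (S n)). specialize (HE n). lra.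
Qed.

(** The second component is damped by z^{-2} at each step and driven by the
    summable terms r_k X^1_k / z. *)
Lemma left_jost_snd_lim (q r : Z -> C) (z : C) (X : Z -> C * C) (S K : R) :
  pot_le q r S -> (1 < Cmod z)%R -> left_jost q r z X ->
  (forall k, vnorm (X k) <= K)%R -> Clim (fun n => snd (X (Z.of_nat n))) (RtoC 0).
Proof.
  intros HS Hz HX HK.
  assert (Hz1 : (1 <= Cmod z)%R) by lra.
  assert (K0 : (0 <= K)%R) by (eapply Rle_trans; [apply vnorm_pos|apply (HK 0%Z)]).
  apply lim0_contraction with (th := (/ (Cmod z * Cmod z))%R) (E := (K * S + 0 * S)%R)
    (eps := fun n => (K * Cmod (r (0 + Z.of_nat n)%Z))%R).
  - split.
    + left. apply Rinv_0_lt_compat. nra.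
    + rewrite <- Rinv_1. apply Rinv_lt_contravar; nra.
  - intros n. apply Cmod_ge_0.
  - intros n. rewrite (sum_n_wsum (fun k => (K * Cmod (r k))%R)).
    apply (Zsum_le_linear K 0 _ _ (fun k => (K * Cmod (r k))%R) S S K0 (Rle_refl 0) HS HS).
    intros j. generalize (Cmod_ge_0 (q j)) (Cmod_ge_0 (r j)). nra.
  - intros n. rewrite Nat2Z.inj_succ, <- Z.add_1_r, (proj1 HX), Z.add_0_l.
    unfold mv, tm; simpl.
    replace (r (Z.of_nat n) / z * fst (X (Z.of_nat n)) +
       / (z * z) * snd (X (Z.of_nat n)) - RtoC 0) with
      (r (Z.of_nat n) / z * fst (X (Z.of_nat n)) +
       / (z * z) * (snd (X (Z.of_nat n)) - RtoC 0)) by ring.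
    eapply Rle_trans; [apply Cmod_triangle|]. rewrite !Cmod_mult.
    rewrite Cmod_inv, Cmod_mult by (apply Cmult_neq_0; now apply Cmod_ge_1_nz).
    rewrite Rplus_comm. apply Rplus_le_compat_l. rewrite Rmult_comm.
    apply Rmult_le_compat; auto using Cmod_ge_0.
    + specialize (HK (Z.of_nat n)). unfold vnorm in HK.
      generalize (Cmod_ge_0 (snd (X (Z.of_nat n)))). lra.
    + now apply Cmod_div_le.
Qed.

Lemma pot_prod_le (q r : Z -> C) (S : R) :
  pot_le q r S -> Zsum_le (fun k => Cmod (r k * q k)) (S * S + 0 * S).
Proof.
  intros HS.
  apply Zsum_le_linear with (1 := Zsum_le_pos _ _ HS) (2 := Rle_refl 0) (3 := HS) (4 := HS).
  intros j. split; [apply Cmod_ge_0|]. rewrite Cmod_mult.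
  assert (T := Zsum_le_term _ _ j HS). cbv beta in T.
  generalize (Cmod_ge_0 (q j)) (Cmod_ge_0 (r j)). nra.
Qed.

(** With y = (Y^2, Y^1) for Y_k = z^k psi_k, the inverse transfer matrix again
    has the form diag(1, z^{-2}) up to summable errors, so that [jost_exists]
    applies. Inverting costs the factor 1/(1 - r_k q_k), which is summably
    close to 1. *)
Lemma psi_exists (q r : Z -> C) (z : C) (S : R) :
  pot_le q r S -> (1 <= Cmod z)%R -> (forall k, RtoC 1 - r k * q k <> RtoC 0) ->
  exists psi, is_psi q r z psi.
Proof.
  intros HS Hz Hp.
  assert (Hz0 := Cmod_ge_1_nz z Hz).
  destruct (inv_one_minus_bounded (fun k => r k * q k) _ (pot_prod_le q r S HS) Hp)
    as [c [Hc1 Hc]].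
  assert (HS0 := Zsum_le_pos _ _ HS).
  set (N := fun k => Mat (/ (RtoC 1 - r k * q k))
    (- (r k / z) * / (RtoC 1 - r k * q k)) (- (q k / z) * / (RtoC 1 - r k * q k))
    (/ (z * z) * / (RtoC 1 - r k * q k))).
  assert (HN : forall k, near_id (c * (S + 1) * (Cmod (q k) + Cmod (r k)))%R (N k)).
  { intros k. unfold near_id, N; simpl. rewrite !Cmod_mult, !Cmod_opp.
    set (p := RtoC 1 - r k * q k) in *.
    replace (/ p - RtoC 1) with (r k * q k * / p) by (unfold p; field; apply Hp).
    rewrite !Cmod_mult.
    assert (Tp : (Cmod (/ p) <= 1 + Cmod (r k) * Cmod (q k) * Cmod (/ p))%R).
    { rewrite <- !Cmod_mult. rewrite <- Cmod_1 at 1.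
      replace (/ p) with (RtoC 1 + r k * q k * / p) at 1 by (unfold p; field; apply Hp).
      apply Cmod_triangle. }
    assert (T := Zsum_le_term _ _ k HS). cbv beta in T.
    specialize (Hc k). cbv beta in Hc. fold p in Hc.
    generalize (Cmod_div_le (q k) z Hz) (Cmod_div_le (r k) z Hz) (Cmod_inv_sq_le z Hz)
      (Cmod_ge_0 (q k)) (Cmod_ge_0 (r k)) (Cmod_ge_0 (/ p)) (Cmod_ge_0 (q k / z))
      (Cmod_ge_0 (r k / z)) (Cmod_ge_0 (/ (z * z))).
    set (P := Cmod (/ p)) in *. set (a := Cmod (q k)) in *. set (b := Cmod (r k)) in *.
    generalize (Cmod (q k / z)) (Cmod (r k / z)) (Cmod (/ (z * z))). intros x y w.
    intros.
    assert (b * a * P <= c * (S * (a + b)) )%R.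
    { rewrite Rmult_comm. apply Rmult_le_compat; nra. }
    assert (x * P <= c * a)%R by (rewrite Rmult_comm; apply Rmult_le_compat; lra).
    assert (y * P <= c * b)%R by (rewrite Rmult_comm; apply Rmult_le_compat; lra).
    assert (w * P <= 1 * P)%R by (apply Rmult_le_compat; lra).
    assert (0 <= c * a)%R by nra. assert (0 <= c * b)%R by nra.
    split; nra. }
  assert (HN' : Zsum_le (fun k => (c * (S + 1) * (Cmod (q k) + Cmod (r k)))%R)
    (c * (S + 1) * S + 0 * S)).
  { apply Zsum_le_linear with (fun k => (Cmod (q k) + Cmod (r k))%R)
      (fun k => (Cmod (q k) + Cmod (r k))%R); auto; try nra.
    intros j. generalize (Cmod_ge_0 (q j)) (Cmod_ge_0 (r j)). intros.
    assert (0 <= c * (S + 1))%R by nra. nra. }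
  destruct (jost_exists _ _ N HN' HN) as [y [[Hy Hlim] _]].
  exists (fun k => scale (zpow z (- k)) (snd (y k), fst (y k))). split.
  - intros k. rewrite (Hy k). unfold scale, mv, N; simpl.
    rewrite !zpow_neg, zpow_succ by auto. f_equal; field; repeat split; auto using zpow_nz.
  - apply tends_Clim.
    apply vdist_lim in Hlim. destruct Hlim as [L1 L2].
    split; [apply Clim_ext with (2 := L2)|apply Clim_ext with (2 := L1)];
      intros n; unfold scale; simpl; rewrite zpow_neg by auto; field; now apply zpow_nz.
Qed.

Lemma left_jost_bound (q r : Z -> C) (z : C) (S : R) (X : Z -> C * C) (k : Z) :
  pot_le q r S -> (1 <= Cmod z)%R -> left_jost q r z X -> (vnorm (X k) <= exp S)%R.
Proof.
  intros HS Hz HX. apply left_jost_is_jost in HX.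
  rewrite <- (Z.opp_involutive k).
  exact (jost_bound _ S _ (Zsum_le_reflect _ _ HS)
    (fun k => proj1 (tm_near_id q r z (- k - 1) Hz)) _ (- k)%Z HX).
Qed.

Lemma right_jost_bound (q r : Z -> C) (z : C) (S : R) (l : Z -> C * C) (k : Z) :
  pot_le q r S -> (1 <= Cmod z)%R -> right_jost q r z l -> (vnorm (l k) <= exp S)%R.
Proof.
  intros HS Hz Hl.
  exact (jost_bound _ S _ HS (fun k => proj2 (tm_near_id q r z k Hz)) _ k Hl).
Qed.

Lemma left_jost_unique (q r q' r' : Z -> C) (z : C) (S : R) (X X' : Z -> C * C) (k : Z) :
  pot_le q r S -> (1 <= Cmod z)%R ->
  (forall j, (j < k)%Z -> q' j = q j /\ r' j = r j) ->
  left_jost q r z X -> left_jost q' r' z X' -> X k = X' k.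
Proof.
  intros HS Hz Hqr HX HX'. apply left_jost_is_jost in HX, HX'.
  rewrite <- (Z.opp_involutive k).
  apply (jost_unique _ S _ (Zsum_le_reflect _ _ HS)
    (fun k => proj1 (tm_near_id q r z (- k - 1) Hz))
    (fun k => X (- k)%Z) (fun k => X' (- k)%Z) (- k)%Z).
  - intros j _. apply (proj1 HX).
  - intros j Hj. destruct (Hqr (- j - 1)%Z ltac:(lia)) as [E1 E2].
    rewrite (proj1 HX' j). unfold tm. now rewrite E1, E2.
  - apply HX.
  - apply HX'.
Qed.

Lemma right_jost_unique (q r q' r' : Z -> C) (z : C) (S : R) (l l' : Z -> C * C) (k : Z) :
  pot_le q r S -> (1 <= Cmod z)%R ->
  (forall j, (k <= j)%Z -> q' j = q j /\ r' j = r j) ->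
  right_jost q r z l -> right_jost q' r' z l' -> l k = l' k.
Proof.
  intros HS Hz Hqr Hl Hl'.
  apply (jost_unique _ S _ HS (fun k => proj2 (tm_near_id q r z k Hz)) l l' k).
  - intros j _. apply (proj1 Hl).
  - intros j Hj. destruct (Hqr j Hj) as [E1 E2].
    rewrite (proj1 Hl' j). unfold tm. now rewrite E1, E2.
  - apply Hl.
  - apply Hl'.
Qed.

(** * The coefficient a and its logarithmic gradient *)

Lemma scale_scale (c d : C) (x : C * C) : scale c (scale d x) = scale (c * d) x.
Proof. unfold scale; simpl. f_equal; ring. Qed.

Lemma scale_1 (x : C * C) : scale (RtoC 1) x = x.
Proof. destruct x. unfold scale; simpl. f_equal; ring. Qed.

Lemma zpow_neg_l (z : C) (k : Z) : z <> RtoC 0 -> zpow z (- k) * zpow z k = RtoC 1.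
Proof. intros Hz. rewrite zpow_neg by auto. field. now apply zpow_nz. Qed.

Lemma zs_of_left (q r : Z -> C) (z c : C) (X : Z -> C * C) : z <> RtoC 0 ->
  (forall k, X (k + 1)%Z = mv (tm q r z k) (X k)) ->
  zs_solution q r z (fun k => scale c (scale (zpow z k) (X k))).
Proof.
  intros Hz H k. rewrite H, zpow_succ by auto. unfold scale, mv, tm; simpl.
  f_equal; field; auto.
Qed.

Lemma left_of_phi (q r : Z -> C) (z : C) (phi : Z -> C * C) : z <> RtoC 0 ->
  is_phi q r z phi -> left_jost q r z (fun k => scale (zpow z (- k)) (phi k)).
Proof.
  intros Hz [H1 H2]. split.
  - intros k. rewrite (H1 k), !zpow_neg, zpow_succ by auto. unfold scale, mv, tm; simpl.
    f_equal; field; split; auto using zpow_nz.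
  - apply vdist_lim. apply tends_Clim in H2. exact H2.
Qed.

Lemma Clim_geom (w : C) : (Cmod w < 1)%R -> Clim (fun n => Cpow w n) (RtoC 0).
Proof.
  intros H. apply is_lim_seq_ext with (fun n => (Cmod w ^ n)%R).
  - intros n. rewrite <- Cmod_pow. f_equal. ring.
  - apply is_lim_seq_geom. rewrite Rabs_pos_eq; auto using Cmod_ge_0.
Qed.

(** For |z| > 1 the solution psi decays relative to z^k, so dividing phi = b
    psi + a psihat by z^k and letting k -> +oo identifies a as the limit of
    X^1. Conversely phi / a is an admissible psihat, with b = 0. *)
Lemma scat_a_eq (q r : Z -> C) (z : C) (S : R) (X l : Z -> C * C) :
  pot_le q r S -> (1 < Cmod z)%R -> (forall k, RtoC 1 - r k * q k <> RtoC 0) ->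
  left_jost q r z X -> right_jost q r z l -> dot (l 0%Z) (X 0%Z) <> RtoC 0 ->
  scat_a q r z = dot (l 0%Z) (X 0%Z).
Proof.
  intros HS Hz Hp HX Hl Ha.
  assert (Hz1 : (1 <= Cmod z)%R) by lra.
  assert (Hz0 := Cmod_ge_1_nz z Hz1).
  set (a := dot (l 0%Z) (X 0%Z)) in *.
  assert (Xb := fun k => left_jost_bound q r z S X k HS Hz1 HX).
  assert (L1 := left_jost_fst_lim q r z X l _ HX Hl Xb). fold a in L1.
  assert (L2 := left_jost_snd_lim q r z X S _ HS Hz HX Xb).
  assert (Huniq : forall a', is_scat_a q r z a' -> a' = a).
  { intros a' (phi & psi & psihat & b & Hphi & Hpsi & Hpsihat & E).
    assert (HX' := left_of_phi q r z phi Hz0 Hphi).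
    symmetry. apply (Clim_unique (fun n => fst (X (Z.of_nat n)))); [exact L1|].
    destruct Hpsi as [_ Hpsi]. apply tends_Clim in Hpsi.
    destruct Hpsihat as [_ Hpsihat]. apply tends_Clim in Hpsihat.
    assert (G : Clim (fun n => Cpow (/ (z * z)) n) (RtoC 0)).
    { apply Clim_geom. rewrite Cmod_inv, Cmod_mult by now apply Cmult_neq_0.
      rewrite <- Rinv_1. apply Rinv_lt_contravar; nra. }
    assert (L3 := Clim_plus _ _ _ _
      (Clim_mult _ _ _ _ (Clim_const b) (Clim_mult _ _ _ _ G (proj1 Hpsi)))
      (Clim_mult _ _ _ _ (Clim_const a') (proj1 Hpsihat))).
    simpl fst in L3.
    replace (b * (RtoC 0 * RtoC 0) + a' * RtoC 1) with a' in L3 by ring.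
    apply Clim_ext with (2 := L3). intros n.
    rewrite (left_jost_unique q r q r z S _ _ (Z.of_nat n) HS Hz1 ltac:(auto) HX HX').
    rewrite (E (Z.of_nat n)). unfold scale, vadd; simpl.
    rewrite zpow_neg, zpow_nat, Cpow_inv, Cpow_mult_l by (auto using Cmult_neq_0).
    field. now apply Cpow_nz. }
  unfold scat_a. apply (iota_unique (V := C_CompleteNormedModule)); [exact Huniq|].
  destruct (psi_exists q r z S HS Hz1 Hp) as [psi Hpsi].
    exists (fun k => scale (RtoC 1) (scale (zpow z k) (X k))), psi,
      (fun k => scale (/ a) (scale (zpow z k) (X k))), (RtoC 0).
    split; [split|split; [exact Hpsi|split; [split|]]].
    + apply zs_of_left; auto. apply HX.
    + apply tends_Clim. destruct (proj1 (vdist_lim _ _) (proj2 HX)) as [M1 M2].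
      split; [apply Clim_ext with (2 := M1)|apply Clim_ext with (2 := M2)];
        intros n; rewrite scale_1, scale_scale, zpow_neg_l, scale_1; auto.
    + apply zs_of_left; auto. apply HX.
    + apply tends_Clim.
      assert (M1 := Clim_mult _ _ _ _ (Clim_const (/ a)) L1).
      assert (M2 := Clim_mult _ _ _ _ (Clim_const (/ a)) L2).
      replace (/ a * a) with (RtoC 1) in M1 by (field; auto).
      replace (/ a * RtoC 0) with (RtoC 0) in M2 by ring.
      split; [apply Clim_ext with (2 := M1)|apply Clim_ext with (2 := M2)];
        intros n; rewrite !scale_scale, (Cmult_comm _ (/ a)), <- Cmult_assoc,
          zpow_neg_l by auto; unfold scale; simpl; ring.
    + intros k. unfold vadd, scale; simpl. f_equal; field; auto.
Qed.

(** A change of the potentials at k affects neither X_j for j <= k nor l_j for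
    j > k; only M_k in a = l_{k+1} M_k X_k changes. *)
Lemma scat_a_one_site (q r q' r' : Z -> C) (z : C) (S S' : R) (X l : Z -> C * C) (k : Z) :
  pot_le q r S -> pot_le q' r' S' -> (1 < Cmod z)%R ->
  (forall j, RtoC 1 - r' j * q' j <> RtoC 0) ->
  (forall j, j <> k -> q' j = q j /\ r' j = r j) ->
  left_jost q r z X -> right_jost q r z l ->
  dot (l (k + 1)%Z) (mv (tm q' r' z k) (X k)) <> RtoC 0 ->
  scat_a q' r' z = dot (l (k + 1)%Z) (mv (tm q' r' z k) (X k)).
Proof.
  intros HS HS' Hz Hp Hqr HX Hl Ha.
  assert (Hz1 : (1 <= Cmod z)%R) by lra.
  destruct (jost_solutions q' r' z S' HS' Hz1) as (X' & l' & HX' & Hl').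
  assert (E : dot (l' 0%Z) (X' 0%Z) = dot (l (k + 1)%Z) (mv (tm q' r' z k) (X k))).
  { rewrite (left_jost_unique q r q' r' z S X X' k), <- (proj1 HX');
      auto; [|intros; apply Hqr; lia].
    rewrite (right_jost_unique q r q' r' z S l l' (k + 1)%Z);
      auto; [|intros; apply Hqr; lia].
    now apply dot_const with q' r' z. }
  rewrite <- E in *. now apply scat_a_eq with S'.
Qed.

Lemma affine_nz (c0 c1 x : C) : c0 + c1 * x <> RtoC 0 ->
  exists rho, (0 < rho)%R /\ forall y, (Cmod (y - x) < rho)%R -> c0 + c1 * y <> RtoC 0.
Proof.
  intros H. assert (Hm := Cmod_ge_0 c1). assert (Hc := proj1 (Cmod_gt_0 _) H).
  exists (Cmod (c0 + c1 * x) / (Cmod c1 + 1))%R. split; [apply Rdiv_lt_0_compat; lra|].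
  intros y Hy E.
  assert (E2 : c0 + c1 * x = - (c1 * (y - x))).
  { transitivity (c0 + c1 * y - c1 * (y - x)); [ring|]. rewrite E. ring. }
  apply Rmult_lt_compat_r with (r := (Cmod c1 + 1)%R) in Hy; [|lra].
  unfold Rdiv in Hy. rewrite Rmult_assoc, Rinv_l, Rmult_1_r in Hy by lra.
  rewrite E2, Cmod_opp, Cmod_mult in Hy, Hc. generalize (Cmod_ge_0 (y - x)). nra.
Qed.

Lemma update_other (f : Z -> C) (k j : Z) (t : C) : j <> k -> update f k t j = f j.
Proof. intros H. unfold update. now destruct (Z.eq_dec j k). Qed.

Lemma update_same (f : Z -> C) (k : Z) (t : C) : update f k t k = t.
Proof. unfold update. now destruct (Z.eq_dec k k). Qed.

Lemma pot_le_iff (q r : Z -> C) :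
  (exists S, pot_le q r S) <->
  exists A B, Zsum_le (fun k => Cmod (q k)) A /\ Zsum_le (fun k => Cmod (r k)) B.
Proof.
  split.
  - intros [S H]. exists (1 * S + 0 * S)%R, (1 * S + 0 * S)%R.
    split; apply Zsum_le_linear with (3 := H) (4 := H); try lra; intros j;
      generalize (Cmod_ge_0 (q j)) (Cmod_ge_0 (r j)); lra.
  - intros (A & B & HA & HB). exists (1 * A + 1 * B)%R.
    apply Zsum_le_linear with (3 := HA) (4 := HB); try lra; intros j;
      generalize (Cmod_ge_0 (q j)) (Cmod_ge_0 (r j)); lra.
Qed.

(** Near t0 both 1 - r_k q_k and the affine function c0 + c1 t remain nonzero,
    so that [scat_a_one_site] gives a = c0 + c1 t there. *)
Lemma log_scat_a_deriv_along (q r : Z -> C) (U : C -> Prop) (lg : C -> C) (z : C) (S : R)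
    (X l : Z -> C * C) (k : Z) (qt rt : C -> Z -> C) (c0 c1 d t0 : C) :
  pot_le q r S -> (1 < Cmod z)%R -> log_branch U lg ->
  (forall j, RtoC 1 - r j * q j <> RtoC 0) ->
  left_jost q r z X -> right_jost q r z l ->
  (forall t, exists S', pot_le (qt t) (rt t) S') ->
  (forall t j, j <> k -> qt t j = q j /\ rt t j = r j) ->
  (forall t, RtoC 1 - rt t k * qt t k = RtoC 1 + d * t) -> RtoC 1 + d * t0 <> RtoC 0 ->
  (forall t, dot (l (k + 1)%Z) (mv (tm (qt t) (rt t) z k) (X k)) = c0 + c1 * t) ->
  U (c0 + c1 * t0) ->
  is_derive (K := C_AbsRing) (V := C_NormedModule)
    (fun t => lg (scat_a (qt t) (rt t) z)) t0 (c1 * / (c0 + c1 * t0)).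
Proof.
  intros HS Hz Hlg Hp HX Hl HS' HQR Hd Hd0 Ha HU.
  destruct (log_branch_deriv U lg _ Hlg HU) as [Ha0 Hder].
  destruct (affine_nz c0 c1 t0 Ha0) as [r1 [Hr1 H1]].
  destruct (affine_nz (RtoC 1) d t0 Hd0) as [r2 [Hr2 H2]].
  apply is_derive_Cderiv.
  apply Cderiv_local with (fun t => lg (c0 + c1 * t)) (Rmin r1 r2);
    [now apply Rmin_glb_lt| |now apply Cderiv_affine_comp].
  intros t Ht. assert (M1 := Rmin_l r1 r2). assert (M2 := Rmin_r r1 r2).
  f_equal. specialize (H1 t ltac:(lra)). specialize (H2 t ltac:(lra)).
  destruct (HS' t) as [S' HSt].
  rewrite <- Ha in *. apply scat_a_one_site with q r S S'; auto.
  intros j. destruct (Z.eq_dec j k) as [->|Hj].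
  - now rewrite Hd.
  - destruct (HQR t j Hj) as [-> ->]. auto.
Qed.

(** Divides by a the derivatives of a = l_{k+1} M_k X_k with respect to the
    off-diagonal entries q_k / z and r_k / z of M_k, times 1/z. *)
Definition grad_log_a (z : C) (X l : Z -> C * C) (k : Z) : C * C :=
  (fst (l (k + 1)%Z) * snd (X k) / z * / dot (l 0%Z) (X 0%Z),
   snd (l (k + 1)%Z) * fst (X k) / z * / dot (l 0%Z) (X 0%Z)).

Lemma log_scat_a_vderiv (q r : Z -> C) (U : C -> Prop) (lg : C -> C) (z : C) (S : R)
    (X l : Z -> C * C) (k : Z) :
  pot_le q r S -> (1 < Cmod z)%R -> (forall j, RtoC 1 - r j * q j <> RtoC 0) ->
  log_branch U lg -> left_jost q r z X -> right_jost q r z l ->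
  U (dot (l 0%Z) (X 0%Z)) ->
  is_vderiv (fun q' r' => lg (scat_a q' r' z)) q r k (grad_log_a z X l k).
Proof.
  intros HS Hz Hp Hlg HX Hl HU. unfold grad_log_a.
  assert (Hz0 : z <> RtoC 0) by (apply Cmod_ge_1_nz; lra).
  rewrite <- (dot_const q r z X l 0 (k + 1) HX Hl), (proj1 HX) in *.
  destruct (proj1 (pot_le_iff q r) (ex_intro _ S HS)) as (A & B & HA & HB).
  set (x := X k) in *. set (y := l (k + 1)%Z) in *.
  split; simpl fst; simpl snd.
  - set (c0 := fst y * fst x + snd y * (r k / z * fst x + / (z * z) * snd x)).
    set (c1 := fst y * snd x / z).
    assert (Ea : forall t, dot y (mv (tm (update q k t) r z k) x) = c0 + c1 * t).
    { intros t. unfold dot, mv, tm, c0, c1; simpl. rewrite update_same. field. auto. }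
    assert (Eq : dot y (mv (tm q r z k) x) = c0 + c1 * q k).
    { unfold dot, mv, tm, c0, c1; simpl. field. auto. }
    rewrite Eq in *.
    apply log_scat_a_deriv_along with (U := U) (S := S) (q := q) (r := r) (X := X) (l := l)
      (k := k) (qt := update q k) (rt := fun _ => r) (d := - r k); auto.
    + intros t. apply pot_le_iff. exists (A + Cmod t)%R, B.
      split; auto. now apply Zsum_le_update.
    + intros t j Hj. now rewrite update_other.
    + intros t. rewrite update_same. ring.
    + replace (RtoC 1 + - r k * q k) with (RtoC 1 - r k * q k) by ring. apply Hp.
  - set (c0 := fst y * (fst x + q k / z * snd x) + snd y * (/ (z * z) * snd x)).
    set (c1 := snd y * fst x / z).
    assert (Ea : forall t, dot y (mv (tm q (update r k t) z k) x) = c0 + c1 * t).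
    { intros t. unfold dot, mv, tm, c0, c1; simpl. rewrite update_same. field. auto. }
    assert (Er : dot y (mv (tm q r z k) x) = c0 + c1 * r k).
    { unfold dot, mv, tm, c0, c1; simpl. field. auto. }
    rewrite Er in *.
    apply log_scat_a_deriv_along with (U := U) (S := S) (q := q) (r := r) (X := X) (l := l)
      (k := k) (qt := fun _ => q) (rt := update r k) (d := - q k); auto.
    + intros t. apply pot_le_iff. exists A, (B + Cmod t)%R.
      split; auto. now apply Zsum_le_update.
    + intros t j Hj. now rewrite update_other.
    + intros t. rewrite update_same. ring.
    + replace (RtoC 1 + - q k * r k) with (RtoC 1 - r k * q k) by ring. apply Hp.
Qed.

(** * The gradient of H0 *)

Lemma Csum_change (g g' : nat -> C) (m n : nat) :
  (forall i, i <> m -> g' i = g i) ->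
  Csum g' n = Csum g n + (if le_lt_dec m n then g' m - g m else RtoC 0).
Proof.
  intros H. induction n as [|n IH].
  - rewrite !Csum_0. destruct (le_lt_dec m 0).
    + replace m with 0%nat by lia. ring.
    + rewrite H by lia. ring.
  - rewrite !Csum_S, IH.
    destruct (le_lt_dec m n), (le_lt_dec m (S n)); try lia.
    + rewrite (H (S n)) by lia. ring.
    + replace m with (S n) by lia. ring.
    + rewrite (H (S n)) by lia. ring.
Qed.

Lemma CSeries_change (g g' : nat -> C) (m : nat) :
  ex_series (fun n => Cmod (g n)) -> (forall i, i <> m -> g' i = g i) ->
  CSeries g' = CSeries g + (g' m - g m).
Proof.
  intros Hg H. apply CSeries_unique. apply (Clim_shift _ m).
  apply CSeries_correct in Hg. apply (Clim_shift _ m) in Hg.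
  apply Clim_ext with (2 := Clim_plus _ _ _ _ Hg (Clim_const (g' m - g m))).
  intros n. rewrite (Csum_change g g' m (n + m)) by auto.
  destruct (le_lt_dec m (n + m)); [reflexivity|lia].
Qed.

Lemma sum_Z_change (f f' : Z -> C) (k : Z) :
  ex_series (fun n => Cmod (f (Z.of_nat n))) ->
  ex_series (fun n => Cmod (f (- Z.of_nat n - 1)%Z)) ->
  (forall j, j <> k -> f' j = f j) -> sum_Z f' = f' k + (sum_Z f - f k).
Proof.
  intros Hp Hm H. unfold sum_Z, sum_from. cbv beta.
  destruct (Z_le_gt_dec 0 k) as [Hk|Hk].
  - rewrite (CSeries_change (fun n => f (0 + Z.of_nat n)%Z)
      (fun n => f' (0 + Z.of_nat n)%Z) (Z.to_nat k));
      [|exact Hp|intros; apply H; lia].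
    replace (fun n => f' (- (1 + Z.of_nat n))%Z) with (fun n => f (- (1 + Z.of_nat n))%Z).
    + replace (0 + Z.of_nat (Z.to_nat k))%Z with k by lia. ring.
    + apply functional_extensionality. intros n. rewrite H by lia. reflexivity.
  - rewrite (CSeries_change (fun n => f (- (1 + Z.of_nat n))%Z)
      (fun n => f' (- (1 + Z.of_nat n))%Z) (Z.to_nat (- k - 1)));
      [|apply (ex_series_ext) with (2 := Hm); intros n; do 2 f_equal; lia
       |intros; apply H; lia].
    replace (fun n => f' (0 + Z.of_nat n)%Z) with (fun n => f (0 + Z.of_nat n)%Z).
    + replace (- (1 + Z.of_nat (Z.to_nat (- k - 1))))%Z with k by lia. ring.
    + apply functional_extensionality. intros n. rewrite H by lia. reflexivity.
Qed.

(** As lg 1 = 0 and lg' 1 = 1, |lg (1 - x)| <= 2 |x| for small x. *)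
Lemma lg_summable (U : C -> Prop) (lg : C -> C) (x : Z -> C) (B : R) :
  log_branch U lg -> U (RtoC 1) -> lg (RtoC 1) = RtoC 0 ->
  Zsum_le (fun k => Cmod (x k)) B ->
  ex_series (fun n => Cmod (lg (RtoC 1 - x (Z.of_nat n)))).
Proof.
  intros Hlg HU1 Hlg1 Hx.
  destruct (log_branch_deriv U lg _ Hlg HU1) as [_ Hd].
  destruct (Hd 1%R Rlt_0_1) as [del [Hdel HH]].
  destruct (Zsum_le_small _ _ del Hx Hdel) as [N HN].
  apply (ex_series_incr_n (fun n => Cmod (lg (RtoC 1 - x (Z.of_nat n)))) (S N)).
  apply (ex_series_le (K := R_AbsRing) (V := R_CompleteNormedModule))
    with (fun n => (2 * Cmod (x (Z.of_nat (S N) + Z.of_nat n)%Z))%R).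
  - intros n. unfold norm; simpl norm. change (abs ?u) with (Rabs u).
    rewrite Rabs_pos_eq by apply Cmod_ge_0.
    replace (Z.of_nat (S N) + Z.of_nat n)%Z with (Z.of_nat (S N + n)) by lia.
    set (j := Z.of_nat (S N + n)). specialize (HN j ltac:(lia)).
    specialize (HH (RtoC 1 - x j)).
    replace (RtoC 1 - x j - RtoC 1) with (- x j) in HH by ring.
    rewrite Cmod_opp, Hlg1 in HH. specialize (HH HN).
    replace (lg (RtoC 1 - x j))
      with ((lg (RtoC 1 - x j) - RtoC 0 - - x j * / RtoC 1) + - x j) by (field).
    eapply Rle_trans; [apply Cmod_triangle|]. rewrite Cmod_opp. lra.
  - apply (ex_series_scal (K := R_AbsRing) (V := R_NormedModule)).
    now apply Zsum_le_ex_series with (1 := Hx).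
Qed.

Definition grad_H0 (q r : Z -> C) (k : Z) : C * C :=
  (r k / (RtoC 1 - r k * q k), q k / (RtoC 1 - r k * q k)).

(** Only the term at site k depends on q_k and r_k. *)
Lemma H0_vderiv (q r : Z -> C) (U : C -> Prop) (lg : C -> C) (S : R) (k : Z) :
  pot_le q r S -> log_branch U lg -> U (RtoC 1) -> lg (RtoC 1) = RtoC 0 ->
  U (RtoC 1 - r k * q k) -> is_vderiv (H0 lg) q r k (grad_H0 q r k).
Proof.
  intros HS Hlg HU1 Hlg1 HU.
  destruct (log_branch_deriv U lg _ Hlg HU) as [Hp Hd].
  assert (Hprod := pot_prod_le q r S HS).
  assert (S1 := lg_summable U lg (fun j => r j * q j) _ Hlg HU1 Hlg1 Hprod).
  assert (S2 := lg_summable U lg (fun j => r (- j - 1)%Z * q (- j - 1)%Z) _ Hlg HU1 Hlg1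
    (Zsum_le_reflect _ _ Hprod)).
  set (f := fun j => lg (RtoC 1 - r j * q j)) in *.
  assert (Along : forall (qt rt : C -> Z -> C) (d t0 : C),
    (forall t j, j <> k -> qt t j = q j /\ rt t j = r j) ->
    (forall t, RtoC 1 - rt t k * qt t k = RtoC 1 + - d * t) ->
    RtoC 1 + - d * t0 = RtoC 1 - r k * q k ->
    is_derive (K := C_AbsRing) (V := C_NormedModule)
      (fun t => H0 lg (qt t) (rt t)) t0 (d / (RtoC 1 - r k * q k))).
  { intros qt rt d t0 HQR Hdt Ht0. apply is_derive_Cderiv.
    replace (d / (RtoC 1 - r k * q k)) with (- (- d * / (RtoC 1 - r k * q k)))
      by (field; auto).
    apply Cderiv_local with (fun t => - (lg (RtoC 1 + - d * t) + (sum_Z f - f k))) 1%R.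
    - lra.
    - intros t _. unfold H0. f_equal. rewrite (sum_Z_change f _ k S1 S2).
      + now rewrite Hdt.
      + intros j Hj. destruct (HQR t j Hj) as [-> ->]. reflexivity.
    - apply (Cderiv_opp_const (fun t => lg (RtoC 1 + - d * t))), Cderiv_affine_comp.
      rewrite Ht0. exact Hd. }
  split; simpl fst; simpl snd.
  - apply (Along (update q k) (fun _ => r)); [|intros t; rewrite update_same; ring|ring].
    intros t j Hj. now rewrite update_other.
  - apply (Along (fun _ => q) (update r k)); [|intros t; rewrite update_same; ring|ring].
    intros t j Hj. now rewrite update_other.
Qed.

(** * Sums over half lines, boundedness of L, and Neumann series *)

Lemma sum_from_ex (e : Z -> R) (S B : R) (f : Z -> C) (k : Z) :
  Zsum_le e S -> (forall j, Cmod (f j) <= B * e j)%R ->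
  ex_series (fun n => Cmod (f (k + Z.of_nat n)%Z)).
Proof.
  intros HS H.
  apply (ex_series_le (K := R_AbsRing) (V := R_CompleteNormedModule))
    with (fun n => (B * e (k + Z.of_nat n)%Z)%R).
  - intros n. unfold norm; simpl norm. change (abs ?u) with (Rabs u).
    rewrite Rabs_pos_eq by apply Cmod_ge_0. apply H.
  - apply (ex_series_scal (K := R_AbsRing) (V := R_NormedModule)).
    now apply Zsum_le_ex_series with (1 := HS).
Qed.

Lemma sum_from_bound (e : Z -> R) (S B : R) (f : Z -> C) (k : Z) :
  (0 <= B)%R -> Zsum_le e S -> (forall j, Cmod (f j) <= B * e j)%R ->
  (Cmod (sum_from k f) <= B * S)%R.
Proof.
  intros HB HS H.
  assert (Hf := CSeries_correct _ (sum_from_ex e S B f k HS H)).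
  assert (Hb : forall n, (Cmod (Csum (fun i => f (k + Z.of_nat i)%Z) n) <= B * S)%R).
  { intros n. apply Rle_trans with (B * wsum e k (Datatypes.S n))%R;
      [|apply Rmult_le_compat_l; [auto|apply HS]].
    induction n as [|n IH].
    - rewrite Csum_0. simpl. rewrite Rplus_0_l. apply H.
    - rewrite Csum_S. eapply Rle_trans; [apply Cmod_triangle|].
      cbn [wsum] in *. specialize (H (k + Z.of_nat (Datatypes.S n))%Z). lra. }
  fold (sum_from k f) in Hf.
  assert (L : is_lim_seq (fun n => (Cmod (Csum (fun i => f (k + Z.of_nat i)%Z) n
     - sum_from k f) + B * S)%R) (0 + B * S)%R).
  { apply is_lim_seq_plus'; [exact Hf|apply is_lim_seq_const]. }
  rewrite Rplus_0_l in L.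
  refine (is_lim_seq_le (fun _ => Cmod (sum_from k f)) _ _ (B * S)%R _ (is_lim_seq_const _) L).
  intros n. specialize (Hb n). rewrite Cmod_minus_sym.
  generalize (Cmod_triangle (sum_from k f - Csum (fun i => f (k + Z.of_nat i)%Z) n)
    (Csum (fun i => f (k + Z.of_nat i)%Z) n)).
  replace (sum_from k f - Csum (fun i => f (k + Z.of_nat i)%Z) n
    + Csum (fun i => f (k + Z.of_nat i)%Z) n) with (sum_from k f) by ring. lra.
Qed.

Lemma sum_from_linear (e : Z -> R) (S B B' : R) (f g h : Z -> C) (c : C) (k : Z) :
  Zsum_le e S -> (forall j, Cmod (f j) <= B * e j)%R -> (forall j, Cmod (g j) <= B' * e j)%R ->
  (forall j, h j = f j + c * g j) ->
  sum_from k h = sum_from k f + c * sum_from k g.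
Proof.
  intros HS Hf Hg Hh. unfold sum_from. apply CSeries_unique.
  assert (Lf := CSeries_correct _ (sum_from_ex e S B f k HS Hf)).
  assert (Lg := CSeries_correct _ (sum_from_ex e S B' g k HS Hg)).
  apply Clim_ext with (2 := Clim_plus _ _ _ _ Lf (Clim_mult _ _ _ _ (Clim_const c) Lg)).
  intros n. induction n as [|n IH].
  - now rewrite !Csum_0, Hh.
  - rewrite !Csum_S, <- IH, Hh. ring.
Qed.

Lemma Clim_Zshift (F : Z -> C) (l : C) (k : Z) :
  Clim (fun n => F (Z.of_nat n)) l -> Clim (fun n => F (k + Z.of_nat n)%Z) l.
Proof.
  intros H. destruct (Z_le_gt_dec 0 k).
  - apply (Clim_shift _ (Z.to_nat k)) in H. apply Clim_ext with (2 := H).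
    intros n. f_equal. lia.
  - apply (Clim_shift _ (Z.to_nat (- k))). apply Clim_ext with (2 := H).
    intros n. f_equal. lia.
Qed.

Lemma sum_from_telescope (f F : Z -> C) (k : Z) :
  (forall j, f j = F j - F (j + 1)%Z) -> Clim (fun n => F (Z.of_nat n)) (RtoC 0) ->
  sum_from k f = F k.
Proof.
  intros Hf HF. apply CSeries_unique.
  assert (L := Clim_plus _ _ _ _ (Clim_const (F k))
    (Clim_mult _ _ _ _ (Clim_const (- RtoC 1)) (Clim_Zshift F _ (k + 1) HF))).
  replace (F k + - RtoC 1 * RtoC 0) with (F k) in L by ring.
  apply Clim_ext with (2 := L). intros n. induction n as [|n IH].
  - rewrite Csum_0, Hf. rewrite !Z.add_0_r. ring.
  - rewrite Csum_S, <- IH, Hf.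
    replace (k + 1 + Z.of_nat n)%Z with (k + Z.of_nat (S n))%Z by lia.
    replace (k + 1 + Z.of_nat (S n))%Z with (k + Z.of_nat (S n) + 1)%Z by lia. ring.
Qed.

Definition vbounded (B : R) (w : Z -> C * C) : Prop :=
  forall k, (Cmod (fst (w k)) <= B /\ Cmod (snd (w k)) <= B)%R.

(** Boundedness and linearity on bounded sequences only: the half-line sums in
    L need not converge on others. *)
Definition bounded_linear (T : (Z -> C * C) -> Z -> C * C) (K : R) : Prop :=
  (forall B w, vbounded B w -> vbounded (K * B) (T w)) /\
  (forall B B' c w w', vbounded B w -> vbounded B' w' ->
    forall k, T (fun j => vadd (w j) (scale c (w' j))) k = vadd (T w k) (scale c (T w' k))).

Lemma vbounded_pos (B : R) (w : Z -> C * C) : vbounded B w -> (0 <= B)%R.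
Proof. intros H. generalize (proj1 (H 0%Z)) (Cmod_ge_0 (fst (w 0%Z))). lra. Qed.

Lemma s_term_bound (q r : Z -> C) (c B : R) (w : Z -> C * C) (j : Z) :
  (Cmod (/ (RtoC 1 - r j * q j)) <= c)%R -> vbounded B w ->
  (Cmod (s_term q r w j) <= c * B * (Cmod (q j) + Cmod (r j)))%R.
Proof.
  intros Hc Hw. unfold s_term, Cdiv. rewrite Cmod_mult.
  assert (H1 : (Cmod (q j * fst (w j) - r j * snd (w j)) <= B * (Cmod (q j) + Cmod (r j)))%R).
  { eapply Rle_trans; [apply Cmod_triangle|]. rewrite Cmod_opp, !Cmod_mult.
    destruct (Hw j). generalize (Cmod_ge_0 (q j)) (Cmod_ge_0 (r j)). nra. }
  rewrite Rmult_comm, Rmult_assoc.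
  apply Rmult_le_compat; auto using Cmod_ge_0.
Qed.

Lemma t_term_bound (q r : Z -> C) (B : R) (w : Z -> C * C) (j : Z) : vbounded B w ->
  (Cmod (q j * fst (w (j - 1)%Z) - r j * snd (w (j + 1)%Z)) <= B * (Cmod (q j) + Cmod (r j)))%R.
Proof.
  intros Hw. eapply Rle_trans; [apply Cmod_triangle|]. rewrite Cmod_opp, !Cmod_mult.
  destruct (Hw (j - 1)%Z) as [H1 _]. destruct (Hw (j + 1)%Z) as [_ H2].
  generalize (Cmod_ge_0 (q j)) (Cmod_ge_0 (r j)). nra.
Qed.

Lemma pot_terms (q r : Z -> C) (S : R) (k : Z) : pot_le q r S ->
  (Cmod (q k) <= S /\ Cmod (r k) <= S /\ Cmod (RtoC 1 - r k * q k) <= 1 + S * S)%R.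
Proof.
  intros HS. assert (T := Zsum_le_term _ _ k HS). cbv beta in T.
  generalize (Cmod_ge_0 (q k)) (Cmod_ge_0 (r k)). intros. repeat split; try lra.
  eapply Rle_trans; [apply Cmod_triangle|]. rewrite Cmod_opp, Cmod_mult, Cmod_1. nra.
Qed.

Lemma opL_bounded_linear (q r : Z -> C) (S c : R) :
  pot_le q r S -> (1 <= c)%R -> (forall k, Cmod (/ (RtoC 1 - r k * q k)) <= c)%R ->
  bounded_linear (opL q r) (1 + (1 + S * S) * S * (c * S) + S * S).
Proof.
  intros HS Hc1 Hc. assert (HS0 := Zsum_le_pos _ _ HS). split.
  - intros B w Hw k. assert (HB := vbounded_pos B w Hw).
    assert (Hs := fun k => sum_from_bound _ S (c * B) (s_term q r w) k ltac:(nra) HS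
      (fun j => s_term_bound q r c B w j (Hc j) Hw)).
    assert (Ht := fun k => sum_from_bound _ S B
      (fun j => q j * fst (w (j - 1)%Z) - r j * snd (w (j + 1)%Z)) k HB HS
      (fun j => t_term_bound q r B w j Hw)).
    assert (Main : forall u x p s y t : C, (Cmod u <= B -> Cmod x <= S -> Cmod y <= S ->
      Cmod p <= 1 + S * S -> Cmod s <= c * B * S -> Cmod t <= B * S ->
      Cmod (u - p * x * s - y * t) <= (1 + (1 + S * S) * S * (c * S) + S * S) * B)%R).
    { intros u x p s y t Hu Hx Hy Hp Hs' Ht'.
      unfold Cminus. eapply Rle_trans; [apply Cmod_triangle|].
      apply Rle_trans with (Cmod u + Cmod (- (p * x * s)) + Cmod (- (y * t)))%R;
        [apply Rplus_le_compat_r, Cmod_triangle|].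
      rewrite !Cmod_opp, !Cmod_mult.
      assert (Cmod p * Cmod x * Cmod s <= (1 + S * S) * S * (c * B * S))%R.
      { apply Rmult_le_compat; auto using Cmod_ge_0.
        - apply Rmult_le_pos; apply Cmod_ge_0.
        - apply Rmult_le_compat; auto using Cmod_ge_0. }
      assert (Cmod y * Cmod t <= S * (B * S))%R
        by (apply Rmult_le_compat; auto using Cmod_ge_0).
      nra. }
    unfold opL; simpl. split; apply Main; auto; try apply Hw; try apply (pot_terms q r S _ HS).
  - intros B B' d w w' Hw Hw' k.
    assert (Es : forall k, sum_from k (s_term q r (fun j => vadd (w j) (scale d (w' j)))) =
      sum_from k (s_term q r w) + d * sum_from k (s_term q r w')).
    { intros i. apply (sum_from_linear _ S (c * B) (c * B') _ _ _ d i HS).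
      - intros j. now apply s_term_bound.
      - intros j. now apply s_term_bound.
      - intros j. unfold s_term, vadd, scale, Cdiv; simpl. ring. }
    assert (Et : forall k, sum_from k (fun j =>
        q j * fst (vadd (w (j - 1)%Z) (scale d (w' (j - 1)%Z))) -
        r j * snd (vadd (w (j + 1)%Z) (scale d (w' (j + 1)%Z)))) =
      sum_from k (fun j => q j * fst (w (j - 1)%Z) - r j * snd (w (j + 1)%Z)) +
      d * sum_from k (fun j => q j * fst (w' (j - 1)%Z) - r j * snd (w' (j + 1)%Z))).
    { intros i. apply (sum_from_linear _ S B B' _ _ _ d i HS).
      - intros j. now apply t_term_bound.
      - intros j. now apply t_term_bound.
      - intros j. unfold vadd, scale; simpl. ring. }
    unfold opL. rewrite !Es, !Et. unfold vadd, scale; simpl. f_equal; ring.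
Qed.

(** Iterating G = w + c T G gives G = sum_{i <= n} c^i T^i w + c^{n+1} T^{n+1}
    G, and the last term is at most (|c| K)^{n+1} B. *)
Lemma neumann (T : (Z -> C * C) -> Z -> C * C) (K B : R) (c : C) (w G : Z -> C * C) :
  bounded_linear T K -> (0 <= K)%R -> (Cmod c * K < 1)%R -> vbounded B G ->
  (exists B', vbounded B' w) ->
  (forall k, G k = vadd (w k) (scale c (T G k))) -> is_resolvent T c w G.
Proof.
  intros [Tb Tl] HK Hc HG [B' Hw] E.
  assert (HB := vbounded_pos _ _ HG).
  assert (bG : forall n, vbounded (K ^ n * B) (Nat.iter n T G)).
  { induction n as [|n IH].
    - simpl. now rewrite Rmult_1_l.
    - simpl Nat.iter. replace (K ^ S n * B)%R with (K * (K ^ n * B))%R by (simpl; ring). auto. }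
  assert (bw : forall n, vbounded (K ^ n * B') (Nat.iter n T w)).
  { induction n as [|n IH].
    - simpl. now rewrite Rmult_1_l.
    - simpl Nat.iter. replace (K ^ S n * B')%R with (K * (K ^ n * B'))%R by (simpl; ring). auto. }
  assert (En : forall n k, Nat.iter n T G k =
    vadd (Nat.iter n T w k) (scale c (Nat.iter (S n) T G k))).
  { induction n as [|n IH]; intros k; [apply E|].
    simpl Nat.iter at 1 2. rewrite (functional_extensionality _ _ IH).
    exact (Tl _ _ c _ _ (bw n) (bG (S n)) k). }
  assert (Lim : is_lim_seq (fun n => (B * (Cmod c * K) ^ S n)%R) 0).
  { apply lim0_scal. apply (is_lim_seq_incr_1 (fun n => ((Cmod c * K) ^ n)%R)).
    apply is_lim_seq_geom. rewrite Rabs_pos_eq; auto.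
    apply Rmult_le_pos; auto using Cmod_ge_0. }
  assert (Bd : forall n (x : C), (Cmod x <= K ^ n * B)%R ->
     (Cmod (Cpow c n * x) <= B * (Cmod c * K) ^ n)%R).
  { intros n x Hx. rewrite Cmod_mult, Cmod_pow, Rpow_mult_distr.
    replace (B * (Cmod c ^ n * K ^ n))%R with (Cmod c ^ n * (K ^ n * B))%R by ring.
    apply Rmult_le_compat_l; auto. apply pow_le, Cmod_ge_0. }
  intros k.
  assert (P : forall i : C * C -> C,
    (forall x y, i (vadd x (scale c y)) = i x + c * i y) ->
    forall n, Csum (fun n => Cpow c n * i (Nat.iter n T w k)) n - i (G k) =
      - (Cpow c (S n) * i (Nat.iter (S n) T G k))).
  { intros i Hi. induction n as [|n IH].
    - rewrite Csum_0, (E k), Hi. simpl. ring.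
    - rewrite Csum_S.
      replace (Csum (fun n => Cpow c n * i (Nat.iter n T w k)) n)
        with (Csum (fun n => Cpow c n * i (Nat.iter n T w k)) n - i (G k) + i (G k)) by ring.
      rewrite IH, (En (S n) k), Hi, (Cpow_S c (S n)). ring. }
  split; apply is_series_Clim; apply Clim_dominated with (2 := Lim); intros n.
  - rewrite (P fst), Cmod_opp by reflexivity. apply Bd. apply (bG (S n)).
  - rewrite (P snd), Cmod_opp by reflexivity. apply Bd. apply (bG (S n)).
Qed.

(** * The fixed point equation *)

(** The right-hand side (1 - r_k q_k) (delta_k log a + delta_k H0) of the
    resolvent identity. *)
Definition grad_sum (q r : Z -> C) (z : C) (X l : Z -> C * C) (k : Z) : C * C :=
  scale (RtoC 1 - r k * q k) (vadd (grad_log_a z X l k) (grad_H0 q r k)).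

Definition jost_pair (q r : Z -> C) (z : C) (X l : Z -> C * C) (a : C) : Prop :=
  z <> RtoC 0 /\ (forall k, RtoC 1 - r k * q k <> RtoC 0) /\
  left_jost q r z X /\ right_jost q r z l /\ a <> RtoC 0 /\ a = dot (l 0%Z) (X 0%Z).

(** The entries P^{11}, P^{12}, P^{21} of the matrices P_k = X_k l_k / a; the
    remaining entry is 1 - alpha because tr P_k = 1. *)
Definition alpha (X l : Z -> C * C) (a : C) (k : Z) : C := fst (X k) * fst (l k) / a.
Definition beta (X l : Z -> C * C) (a : C) (k : Z) : C := fst (X k) * snd (l k) / a.
Definition gamma (X l : Z -> C * C) (a : C) (k : Z) : C := snd (X k) * fst (l k) / a.

Lemma jost_pair_dot (q r : Z -> C) (z : C) (X l : Z -> C * C) (a : C) (k : Z) :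
  jost_pair q r z X l a ->
  a = fst (l (k + 1)%Z) * (fst (X k) + q k / z * snd (X k)) +
      snd (l (k + 1)%Z) * (r k / z * fst (X k) + / (z * z) * snd (X k)).
Proof.
  intros (_ & _ & HX & Hl & _ & ->).
  rewrite <- (dot_const q r z X l 0 (k + 1) HX Hl), (proj1 HX k).
  unfold dot, mv, tm; simpl. ring.
Qed.

Lemma right_jost_step (q r : Z -> C) (z : C) (l : Z -> C * C) (k : Z) :
  right_jost q r z l ->
  l k = (fst (l (k + 1)%Z) + r k / z * snd (l (k + 1)%Z),
         q k / z * fst (l (k + 1)%Z) + / (z * z) * snd (l (k + 1)%Z)).
Proof. intros Hl. rewrite (proj1 Hl k) at 1. unfold mv, trmat, tm; simpl. f_equal; ring. Qed.

Lemma left_jost_step (q r : Z -> C) (z : C) (X : Z -> C * C) (k : Z) :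
  left_jost q r z X ->
  X (k + 1)%Z = (fst (X k) + q k / z * snd (X k), r k / z * fst (X k) + / (z * z) * snd (X k)).
Proof. intros HX. rewrite (proj1 HX k). unfold mv, tm; simpl. f_equal; ring. Qed.

Lemma grad_sum_div (q r : Z -> C) (z : C) (X l : Z -> C * C) (a : C) (k : Z) :
  jost_pair q r z X l a ->
  grad_sum q r z X l k =
  (((RtoC 1 - r k * q k) * fst (l (k + 1)%Z) * snd (X k) / z + r k * a) / a,
   ((RtoC 1 - r k * q k) * snd (l (k + 1)%Z) * fst (X k) / z + q k * a) / a).
Proof.
  intros (Hz & Hp & _ & _ & Ha & Ea).
  unfold grad_sum, grad_log_a, grad_H0, scale, vadd; simpl. rewrite <- Ea.
  f_equal; field; auto.
Qed.

(** Each component of [grad_sum] at k has an expression in terms of P_k and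
    one in terms of P_{k+1}: multiplying P_{k+1} = M_k X_k l_{k+1} / a or P_k
    = X_k l_{k+1} M_k / a by the inverse of M_k recovers X_k l_{k+1} / a. *)
Lemma grad_sum_site (q r : Z -> C) (z : C) (X l : Z -> C * C) (a : C) (k : Z) :
  jost_pair q r z X l a ->
  fst (grad_sum q r z X l k) = r k * alpha X l a k + gamma X l a k / z /\
  fst (grad_sum q r z X l k) = r k * (RtoC 1 - alpha X l a (k + 1)) + z * gamma X l a (k + 1) /\
  snd (grad_sum q r z X l k) = q k * (RtoC 1 - alpha X l a k) + z * beta X l a k /\
  snd (grad_sum q r z X l k) = q k * alpha X l a (k + 1) + beta X l a (k + 1) / z.
Proof.
  intros J. rewrite (grad_sum_div q r z X l a k J). assert (E := jost_pair_dot q r z X l a k J).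
  destruct J as (Hz & _ & HX & Hl & Ha & _).
  unfold alpha, beta, gamma. rewrite (right_jost_step q r z l k Hl), (left_jost_step q r z X k HX).
  simpl fst; simpl snd.
  set (x1 := fst (X k)) in *. set (x2 := snd (X k)) in *.
  set (y1 := fst (l (k + 1)%Z)) in *. set (y2 := snd (l (k + 1)%Z)) in *.
  assert (Q : forall x y : C, x = y -> x / a = y / a) by now intros x y ->.
  repeat split.
  - transitivity ((r k * (x1 * (y1 + r k / z * y2)) + x2 * (y1 + r k / z * y2) / z) / a);
      [apply Q; rewrite E|]; field; auto.
  - transitivity ((r k * (a - (x1 + q k / z * x2) * y1)
       + z * ((r k / z * x1 + / (z * z) * x2) * y1)) / a);
      [apply Q; rewrite E|]; field; auto.
  - transitivity ((q k * (a - x1 * (y1 + r k / z * y2))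
       + z * (x1 * (q k / z * y1 + / (z * z) * y2))) / a);
      [apply Q; rewrite E|]; field; auto.
  - transitivity ((q k * ((x1 + q k / z * x2) * y1) + (x1 + q k / z * x2) * y2 / z) / a);
      [apply Q; rewrite E|]; field; auto.
Qed.

(** The (1,1) entries of P_k = Q_k M_k and P_{k+1} = M_k Q_k, with Q_k = X_k
    l_{k+1} / a, subtracted. *)
Lemma alpha_diff (q r : Z -> C) (z : C) (X l : Z -> C * C) (a : C) (k : Z) :
  jost_pair q r z X l a ->
  alpha X l a (k + 1) - alpha X l a k =
  (q k * gamma X l a k - r k * beta X l a (k + 1)) / z.
Proof.
  intros (Hz & _ & HX & Hl & Ha & _). unfold alpha, beta, gamma.
  rewrite (right_jost_step q r z l k Hl), (left_jost_step q r z X k HX).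
  simpl. field; auto.
Qed.

Lemma s_term_grad_sum (q r : Z -> C) (z : C) (X l : Z -> C * C) (a : C) (k : Z) :
  jost_pair q r z X l a ->
  s_term q r (grad_sum q r z X l) k = (RtoC 1 - alpha X l a k) - (RtoC 1 - alpha X l a (k + 1)).
Proof.
  intros J. unfold s_term. rewrite (grad_sum_div q r z X l a k J).
  destruct J as (Hz & Hp & HX & Hl & Ha & _). unfold alpha.
  rewrite (right_jost_step q r z l k Hl), (left_jost_step q r z X k HX).
  simpl. field; auto.
Qed.

(** The shifted components at k - 1 and at k + 1 are expressed through P_k and
    P_{k+1} respectively; the terms that do not telescope visibly combine to
    z^2 (alpha_{k+1} - alpha_k) by [alpha_diff]. *)
Lemma t_term_grad_sum (q r : Z -> C) (z : C) (X l : Z -> C * C) (a : C) (k : Z) :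
  jost_pair q r z X l a ->
  q k * fst (grad_sum q r z X l (k - 1)%Z) - r k * snd (grad_sum q r z X l (k + 1)%Z) =
  (RtoC 1 - alpha X l a k) * (z * z + q k * r (k - 1)%Z)
  - (RtoC 1 - alpha X l a (k + 1)) * (z * z + q (k + 1)%Z * r k).
Proof.
  intros J. destruct (grad_sum_site q r z X l a (k - 1) J) as [_ [-> _]].
  destruct (grad_sum_site q r z X l a (k + 1) J) as [_ [_ [-> _]]].
  rewrite Z.sub_add.
  transitivity (q k * (r (k - 1)%Z * (RtoC 1 - alpha X l a k)) -
    r k * (q (k + 1)%Z * (RtoC 1 - alpha X l a (k + 1))) +
    z * z * ((q k * gamma X l a k - r k * beta X l a (k + 1)) / z)).
  - field. apply J.
  - rewrite <- (alpha_diff q r z X l a k J). ring.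
Qed.

(** At +oo the row l_k tends to e1 and X^1_k to a. *)
Lemma alpha_lim (q r : Z -> C) (z : C) (X l : Z -> C * C) (a : C) (S : R) :
  jost_pair q r z X l a -> pot_le q r S -> (1 < Cmod z)%R ->
  Clim (fun n => RtoC 1 - alpha X l a (Z.of_nat n)) (RtoC 0).
Proof.
  intros (_ & _ & HX & Hl & Ha & Ea) HS Hz1.
  assert (L1 := left_jost_fst_lim q r z X l _ HX Hl
    (fun k => left_jost_bound q r z S X k HS (Rlt_le _ _ Hz1) HX)).
  rewrite <- Ea in L1.
  destruct (proj1 (vdist_lim _ _) (proj2 Hl)) as [L2 _]. simpl fst in L2.
  assert (L := Clim_plus _ _ _ _ (Clim_const (RtoC 1)) (Clim_mult _ _ _ _ (Clim_const (- / a))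
    (Clim_mult _ _ _ _ L1 L2))).
  replace (RtoC 1 + - / a * (a * RtoC 1)) with (RtoC 0) in L by (field; auto).
  apply Clim_ext with (2 := L). intros n. unfold alpha, Cdiv. ring.
Qed.

Lemma pot_lim (q r : Z -> C) (S : R) : pot_le q r S ->
  Clim (fun n => q (Z.of_nat n)) (RtoC 0) /\ Clim (fun n => r (Z.of_nat n)) (RtoC 0).
Proof.
  intros HS. assert (L := Zsum_le_lim _ _ 0 HS).
  split; apply Clim_dominated with (2 := L); intros n; rewrite Z.add_0_l.
  - replace (q (Z.of_nat n) - RtoC 0) with (q (Z.of_nat n)) by ring.
    generalize (Cmod_ge_0 (r (Z.of_nat n))). lra.
  - replace (r (Z.of_nat n) - RtoC 0) with (r (Z.of_nat n)) by ring.
    generalize (Cmod_ge_0 (q (Z.of_nat n))). lra.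
Qed.

Lemma sum_s_grad_sum (q r : Z -> C) (z : C) (X l : Z -> C * C) (a : C) (S : R) (k : Z) :
  jost_pair q r z X l a -> pot_le q r S -> (1 < Cmod z)%R ->
  sum_from k (s_term q r (grad_sum q r z X l)) = RtoC 1 - alpha X l a k.
Proof.
  intros J HS Hz. apply (sum_from_telescope _ (fun k => RtoC 1 - alpha X l a k)).
  - intros j. now apply s_term_grad_sum.
  - now apply alpha_lim with q r z S.
Qed.

Lemma sum_t_grad_sum (q r : Z -> C) (z : C) (X l : Z -> C * C) (a : C) (S : R) (k : Z) :
  jost_pair q r z X l a -> pot_le q r S -> (1 < Cmod z)%R ->
  sum_from k (fun j =>
    q j * fst (grad_sum q r z X l (j - 1)%Z) - r j * snd (grad_sum q r z X l (j + 1)%Z)) =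
  (RtoC 1 - alpha X l a k) * (z * z + q k * r (k - 1)%Z).
Proof.
  intros J HS Hz.
  apply (sum_from_telescope _ (fun k => (RtoC 1 - alpha X l a k) * (z * z + q k * r (k - 1)%Z))).
  - intros j. rewrite (t_term_grad_sum q r z X l a j J). now rewrite Z.add_simpl_r.
  - destruct (pot_lim q r S HS) as [Lq Lr].
    assert (Lr' : Clim (fun n => r (Z.of_nat n - 1)%Z) (RtoC 0)).
    { apply Clim_ext with (2 := Clim_Zshift r _ (-1) Lr). intros n. f_equal. lia. }
    assert (L := Clim_mult _ _ _ _ (alpha_lim q r z X l a S J HS Hz)
      (Clim_plus _ _ _ _ (Clim_const (z * z)) (Clim_mult _ _ _ _ Lq Lr'))).
    replace (RtoC 0 * (z * z + RtoC 0 * RtoC 0)) with (RtoC 0) in L by ring. exact L.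
Qed.

(** Once the two sums are evaluated, both sides are expressions in P_k for the
    first component and in P_{k+1} for the second one, and they agree
    identically. *)
Lemma grad_sum_fixed (q r : Z -> C) (z : C) (X l : Z -> C * C) (a : C) (S : R) (k : Z) :
  jost_pair q r z X l a -> pot_le q r S -> (1 < Cmod z)%R ->
  grad_sum q r z X l k = vadd (r k, q k) (scale (/ (z * z)) (opL q r (grad_sum q r z X l) k)).
Proof.
  intros J HS Hz. unfold opL.
  rewrite !(sum_s_grad_sum q r z X l a S) by auto. rewrite !(sum_t_grad_sum q r z X l a S) by auto.
  rewrite (surjective_pairing (grad_sum q r z X l k)).
  destruct (grad_sum_site q r z X l a k J) as [E1 [_ [_ E4]]].
  destruct (grad_sum_site q r z X l a (k - 1) J) as [_ [E2 _]].
  destruct (grad_sum_site q r z X l a (k + 1) J) as [_ [_ [E3 _]]].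
  rewrite Z.sub_add in E2. rewrite Z.add_simpl_r.
  rewrite E1, E2, E3, E4. assert (Hz0 := proj1 J).
  unfold vadd, scale; simpl. f_equal; field; auto.
Qed.

(** * The first resolvent identity *)

Lemma grad_sum_bounded (q r : Z -> C) (z : C) (X l : Z -> C * C) (S : R) :
  pot_le q r S -> (1 <= Cmod z)%R -> (forall k, RtoC 1 - r k * q k <> RtoC 0) ->
  left_jost q r z X -> right_jost q r z l ->
  exists B, vbounded B (grad_sum q r z X l).
Proof.
  intros HS Hz Hp HX Hl.
  set (A := Cmod (/ dot (l 0%Z) (X 0%Z))). set (E := exp S).
  exists ((1 + S * S) * (E * E * A) + S)%R. intros k.
  assert (HS0 := Zsum_le_pos _ _ HS). assert (HA : (0 <= A)%R) by apply Cmod_ge_0.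
  destruct (pot_terms q r S k HS) as (P1 & P2 & P3).
  assert (Xb := left_jost_bound q r z S X k HS Hz HX).
  assert (lb := right_jost_bound q r z S l (k + 1) HS Hz Hl).
  fold E in Xb, lb. unfold vnorm in Xb, lb.
  assert (Main : forall x y w p c : C, (Cmod x <= E -> Cmod y <= E -> Cmod p <= 1 + S * S ->
    Cmod c <= S -> p <> RtoC 0 -> (w = p * (x * y / z * / dot (l 0%Z) (X 0%Z) + c / p))%C ->
    Cmod w <= (1 + S * S) * (E * E * A) + S)%R).
  { intros x y w p c Hx Hy Hpp Hc Hp0 ->.
    replace (p * (x * y / z * / dot (l 0%Z) (X 0%Z) + c / p))
      with (p * (x * y / z * / dot (l 0%Z) (X 0%Z)) + c) by (set (d := / dot _ _); field;
       split; auto using Cmod_ge_1_nz).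
    eapply Rle_trans; [apply Cmod_triangle|]. apply Rplus_le_compat; auto.
    rewrite (Cmod_mult p), (Cmod_mult (x * y / z)). fold A.
    apply Rmult_le_compat; auto using Cmod_ge_0; [apply Rmult_le_pos; auto using Cmod_ge_0|].
    apply Rmult_le_compat_r; auto.
    eapply Rle_trans; [now apply Cmod_div_le|]. rewrite Cmod_mult.
    apply Rmult_le_compat; auto using Cmod_ge_0. }
  generalize (Cmod_ge_0 (fst (X k))) (Cmod_ge_0 (snd (X k)))
    (Cmod_ge_0 (fst (l (k + 1)%Z))) (Cmod_ge_0 (snd (l (k + 1)%Z))). intros.
  split.
  - apply (Main (fst (l (k + 1)%Z)) (snd (X k)) _ (RtoC 1 - r k * q k) (r k)); auto; lra.
  - apply (Main (snd (l (k + 1)%Z)) (fst (X k)) _ (RtoC 1 - r k * q k) (q k)); auto; lra.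
Qed.

(** X^1 goes from 1 at -oo to a at +oo by increments q_k X^2_k / z, and X is
    bounded uniformly in z. *)
Lemma scat_a_near_1 (q r : Z -> C) (z : C) (X l : Z -> C * C) (S : R) :
  pot_le q r S -> (1 <= Cmod z)%R -> left_jost q r z X -> right_jost q r z l ->
  (Cmod (dot (l 0%Z) (X 0%Z) - RtoC 1) <= exp S * S / Cmod z)%R.
Proof.
  intros HS Hz HX Hl.
  assert (Hz0 := Cmod_ge_1_nz z Hz).
  assert (Xb := fun k => left_jost_bound q r z S X k HS Hz HX).
  assert (L1 := left_jost_fst_lim q r z X l _ HX Hl Xb).
  destruct (proj1 (vdist_lim _ _) (proj2 HX)) as [L2 _]. simpl fst in L2.
  assert (Step : forall k, (Cmod (fst (X (k + 1)%Z) - fst (X k)) <=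
     exp S / Cmod z * (Cmod (q k) + Cmod (r k)))%R).
  { intros k. rewrite (proj1 HX k). unfold mv, tm; simpl.
    replace (RtoC 1 * fst (X k) + q k / z * snd (X k) - fst (X k))
      with (snd (X k) / z * q k) by (field; auto).
    rewrite Cmod_mult, Cmod_div by auto.
    apply Rmult_le_compat; auto using Cmod_ge_0.
    - apply Rmult_le_pos; [apply Cmod_ge_0|]. left. apply Rinv_0_lt_compat. lra.
    - apply Rmult_le_compat_r; [left; apply Rinv_0_lt_compat; lra|].
      specialize (Xb k). unfold vnorm in Xb. generalize (Cmod_ge_0 (fst (X k))). lra.
    - generalize (Cmod_ge_0 (r k)). lra. }
  assert (Win : forall k n, (Cmod (fst (X (k + Z.of_nat n)%Z) - fst (X k)) <=
     exp S / Cmod z * wsum (fun j => Cmod (q j) + Cmod (r j))%R k n)%R).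
  { intros k n. induction n as [|n IH].
    - simpl. rewrite Z.add_0_r. replace (fst (X k) - fst (X k)) with (RtoC 0) by ring.
      rewrite Cmod_0. lra.
    - cbn [wsum].
      replace (k + Z.of_nat (Datatypes.S n))%Z with (k + Z.of_nat n + 1)%Z by lia.
      specialize (Step (k + Z.of_nat n)%Z).
      generalize (Cmod_triangle (fst (X (k + Z.of_nat n + 1)%Z) - fst (X (k + Z.of_nat n)%Z))
        (fst (X (k + Z.of_nat n)%Z) - fst (X k))).
      replace (fst (X (k + Z.of_nat n + 1)%Z) - fst (X (k + Z.of_nat n)%Z) +
        (fst (X (k + Z.of_nat n)%Z) - fst (X k)))
        with (fst (X (k + Z.of_nat n + 1)%Z) - fst (X k)) by ring. lra. }
  assert (L : is_lim_seq (fun n => (Cmod (fst (X (Z.of_nat n)) - dot (l 0%Z) (X 0%Z)) +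
      Cmod (fst (X (- Z.of_nat n)%Z) - RtoC 1) + exp S * S / Cmod z)%R)
      (0 + exp S * S / Cmod z)%R).
  { apply is_lim_seq_plus'; [|apply is_lim_seq_const]. exact (lim0_plus _ _ L1 L2). }
  rewrite Rplus_0_l in L.
  refine (is_lim_seq_le (fun _ => Cmod (dot (l 0%Z) (X 0%Z) - RtoC 1)) _ _
    (exp S * S / Cmod z)%R _ (is_lim_seq_const _) L).
  intros n. specialize (Win (- Z.of_nat n)%Z (n + n)%nat).
  replace (- Z.of_nat n + Z.of_nat (n + n))%Z with (Z.of_nat n) in Win by lia.
  assert (Wb := proj2 HS (- Z.of_nat n)%Z (n + n)%nat).
  assert (W2 : (exp S / Cmod z * wsum (fun j => Cmod (q j) + Cmod (r j))%R (- Z.of_nat n) (n + n)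
    <= exp S * S / Cmod z)%R).
  { replace (exp S * S / Cmod z)%R with (exp S / Cmod z * S)%R by (unfold Rdiv; ring).
    apply Rmult_le_compat_l; auto. apply Rmult_le_pos; [left; apply exp_pos|].
    left. apply Rinv_0_lt_compat. lra. }
  set (x := fst (X (Z.of_nat n))) in *. set (y := fst (X (- Z.of_nat n)%Z)) in *.
  set (d := dot (l 0%Z) (X 0%Z)) in *.
  replace (d - RtoC 1) with (- (x - d) + ((x - y) + (y - RtoC 1))) by ring.
  generalize (Cmod_triangle (- (x - d)) ((x - y) + (y - RtoC 1)))
    (Cmod_triangle (x - y) (y - RtoC 1)). rewrite Cmod_opp. lra.
Qed.

(** R1 is taken so large that z^{-2} L is a contraction and a(z) lies in a
    ball around 1 inside U. *)
Lemma resolvent_L (q r : Z -> C) (U : C -> Prop) (lg : C -> C)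
  (Hq : vanishes_rapidly q) (Hr : vanishes_rapidly r)
  (Hqr : forall k : Z, RtoC 1 - r k * q k <> RtoC 0)
  (Hlg : log_branch U lg) (HU1 : U (RtoC 1)) :
  exists R1 : R, (1 <= R1)%R /\
    forall z : C, (R1 < Cmod z)%R ->
    exists dloga : Z -> C * C,
      (forall k : Z, is_vderiv (fun q' r' => lg (scat_a q' r' z)) q r k (dloga k)) /\
      is_resolvent (opL q r) (zpow z (-2)) (fun k => (r k, q k))
        (fun k => scale (RtoC 1 - r k * q k) (vadd (dloga k) (grad_H0 q r k))).
Proof.
  destruct (proj2 (pot_le_iff q r)) as [S HS].
  { destruct (vanishes_Zsum_le q Hq) as [A HA]. destruct (vanishes_Zsum_le r Hr) as [B HB]. eauto. }
  assert (HS0 := Zsum_le_pos _ _ HS).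
  destruct (inv_one_minus_bounded (fun k => r k * q k) _ (pot_prod_le q r S HS) Hqr)
    as [c [Hc1 Hc]].
  assert (HL := opL_bounded_linear q r S c HS Hc1 Hc).
  set (K := (1 + (1 + S * S) * S * (c * S) + S * S)%R) in *.
  assert (HK : (1 <= K)%R).
  { unfold K. assert (0 <= S * S)%R by nra.
    assert (0 <= (1 + S * S) * S * (c * S))%R by (repeat apply Rmult_le_pos; lra). lra. }
  destruct (proj1 Hlg _ HU1) as [[eta Heta] HB].
  assert (HP : (0 <= exp S * S / eta)%R).
  { apply Rmult_le_pos; [apply Rmult_le_pos; auto; left; apply exp_pos|].
    left. now apply Rinv_0_lt_compat. }
  (* |z| > K makes z^{-2} L a contraction, as |z| >= 1; the second term gives
     |a - 1| < eta. *)
  exists (K + exp S * S / eta)%R. split; [lra|]. intros z Hz.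
  assert (Hz1 : (1 < Cmod z)%R) by lra. assert (Hz1' := Rlt_le _ _ Hz1).
  assert (Hz0 := Cmod_ge_1_nz z Hz1').
  destruct (jost_solutions q r z S HS Hz1') as (X & l & HX & Hl).
  assert (Hnear := scat_a_near_1 q r z X l S HS Hz1' HX Hl).
  assert (HUa : U (dot (l 0%Z) (X 0%Z))).
  { apply HB, ball_of_Cmod. simpl. eapply Rle_lt_trans; [exact Hnear|].
    apply Rmult_lt_reg_r with (Cmod z); [lra|]. unfold Rdiv.
    rewrite Rmult_assoc, Rinv_l, Rmult_1_r by lra.
    replace (exp S * S)%R with (eta * (exp S * S / eta))%R by (field; lra).
    apply Rmult_lt_compat_l; lra. }
  exists (grad_log_a z X l). split.
  - intros k. now apply log_scat_a_vderiv with U S.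
  - destruct (grad_sum_bounded q r z X l S HS Hz1' Hqr HX Hl) as [B Hb].
    replace (zpow z (-2)) with (/ (z * z)) by (simpl; field; auto).
    apply (neumann _ K B); auto; try lra.
    + rewrite Cmod_inv, Cmod_mult by now apply Cmult_neq_0.
      apply Rmult_lt_reg_l with (Cmod z * Cmod z)%R; [nra|].
      rewrite <- Rmult_assoc, Rinv_r, Rmult_1_l, Rmult_1_r by nra. nra.
    + exists S. intros k. destruct (pot_terms q r S k HS) as (P1 & P2 & _). now split.
    + intros k. apply grad_sum_fixed with (dot (l 0%Z) (X 0%Z)) S; auto.
      repeat split; try apply HX; try apply Hl; auto.
      now apply log_branch_deriv with U lg.
Qed.

(** * The second resolvent identity, by symmetry *)

Definition swap (x : C * C) : C * C := (snd x, fst x).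

Lemma swap_swap (x : C * C) : swap (swap x) = x.
Proof. now destruct x. Qed.

Lemma CSeries_opp (f : nat -> C) : CSeries (fun n => - f n) = - CSeries f.
Proof.
  unfold CSeries, Copp; simpl. f_equal; rewrite <- Series_opp; now apply Series_ext.
Qed.

Lemma sum_from_opp (f g : Z -> C) (k : Z) : (forall j, g j = - f j) ->
  sum_from k g = - sum_from k f.
Proof.
  intros H. unfold sum_from. rewrite <- CSeries_opp. f_equal.
  apply functional_extensionality. intros n. apply H.
Qed.

(** Exchanging the components and q with r changes the sign of both summands
    in L. *)
Lemma opLinv_swap (q r : Z -> C) (w : Z -> C * C) (k : Z) :
  opLinv q r w k = swap (opL r q (fun j => swap (w j)) k).
Proof.
  unfold opLinv, opL, swap; simpl.
  assert (Es : forall i, sum_from i (s_term r q (fun j => (snd (w j), fst (w j)))) =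
     - sum_from i (s_term q r w)).
  { intros i. apply sum_from_opp. intros j. unfold s_term; simpl.
    replace (RtoC 1 - q j * r j) with (RtoC 1 - r j * q j) by ring. unfold Cdiv. ring. }
  assert (Et : forall i, sum_from i (fun j =>
       r j * snd (w (j - 1)%Z) - q j * fst (w (j + 1)%Z)) =
     - sum_from i (fun j => q j * fst (w (j + 1)%Z) - r j * snd (w (j - 1)%Z))).
  { intros i. apply sum_from_opp. intros j. ring. }
  rewrite !Es, !Et. f_equal; ring.
Qed.

Lemma resolvent_swap (q r : Z -> C) (c : C) (w v : Z -> C * C) :
  is_resolvent (opL r q) c w v ->
  is_resolvent (opLinv q r) c (fun k => swap (w k)) (fun k => swap (v k)).
Proof.
  intros H k.
  assert (E : forall n, Nat.iter n (opLinv q r) (fun k => swap (w k)) =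
    fun k => swap (Nat.iter n (opL r q) w k)).
  { induction n as [|n IH]; auto. simpl. rewrite IH.
    apply functional_extensionality. intros j. rewrite opLinv_swap.
    reflexivity. }
  destruct (H k) as [H1 H2].
  split; [apply is_series_ext with (2 := H2)|apply is_series_ext with (2 := H1)];
    intros n; now rewrite E.
Qed.

Lemma Cinv_nz (z : C) : z <> RtoC 0 -> / z <> RtoC 0.
Proof. intros Hz E. apply C1_nz. rewrite <- (Cinv_r z Hz), E. ring. Qed.

Lemma Cinv_inv (z : C) : z <> RtoC 0 -> / / z = z.
Proof. intros Hz. field. exact Hz. Qed.

Lemma zpow_inv (z : C) (k : Z) : z <> RtoC 0 -> zpow (/ z) k = zpow z (- k).
Proof.
  intros Hz. rewrite zpow_neg by auto. destruct k as [|p|p]; simpl.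
  - field.
  - now apply Cpow_inv.
  - now rewrite Cpow_inv.
Qed.

(** The transfer matrix for (r, q, 1/z) is the one for (q, r, z) with rows and
    columns exchanged. *)
Lemma zs_swap (q r : Z -> C) (z : C) (nu : Z -> C * C) : z <> RtoC 0 ->
  zs_solution q r z nu <-> zs_solution r q (/ z) (fun k => swap (nu k)).
Proof.
  intros Hz. unfold zs_solution, swap; simpl. rewrite Cinv_inv by auto.
  split; intros H k; specialize (H k).
  - rewrite H; simpl. f_equal; ring.
  - rewrite (surjective_pairing (nu (k + 1)%Z)).
    injection H as H1 H2. rewrite H1, H2. f_equal; ring.
Qed.

Lemma tends_swap (f g : nat -> C * C) (l : C * C) : (forall n, g n = swap (f n)) ->
  filterlim f eventually (locally l) <-> filterlim g eventually (locally (swap l)).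
Proof.
  rewrite !tends_Clim. intros H.
  split; intros [H1 H2]; (split; [apply Clim_ext with (2 := H2)|apply Clim_ext with (2 := H1)]);
    intros n; now rewrite H.
Qed.

Lemma phihat_swap (q r : Z -> C) (z : C) (nu : Z -> C * C) : z <> RtoC 0 ->
  is_phihat q r z nu <-> is_phi r q (/ z) (fun k => swap (nu k)).
Proof.
  intros Hz. unfold is_phihat, is_phi. rewrite (zs_swap q r z nu Hz).
  apply and_iff_compat_l. apply (tends_swap _ _ (RtoC 0, RtoC 1)).
  intros n. rewrite zpow_inv, Z.opp_involutive by auto. reflexivity.
Qed.

Lemma psi_swap (q r : Z -> C) (z : C) (nu : Z -> C * C) : z <> RtoC 0 ->
  is_psi q r z nu <-> is_psihat r q (/ z) (fun k => swap (nu k)).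
Proof.
  intros Hz. unfold is_psi, is_psihat. rewrite (zs_swap q r z nu Hz).
  apply and_iff_compat_l. apply (tends_swap _ _ (RtoC 0, RtoC 1)).
  intros n. rewrite zpow_inv, Z.opp_involutive by auto. reflexivity.
Qed.

Lemma psihat_swap (q r : Z -> C) (z : C) (nu : Z -> C * C) : z <> RtoC 0 ->
  is_psihat q r z nu <-> is_psi r q (/ z) (fun k => swap (nu k)).
Proof.
  intros Hz. rewrite (psi_swap r q (/ z)), Cinv_inv by auto using Cinv_nz.
  replace (fun k => swap (swap (nu k))) with nu; [reflexivity|].
  apply functional_extensionality. intros k. now rewrite swap_swap.
Qed.

(** Exchanging components sends phihat, psi, psihat to phi, psihat, psi. *)
Lemma scat_ahat_eq (q r : Z -> C) (z : C) : z <> RtoC 0 ->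
  scat_ahat q r z = scat_a r q (/ z).
Proof.
  intros Hz. apply (eq_close (V := C_NormedModule)).
  apply (close_iota (T := C_CompleteNormedModule)). intros a. split.
  - intros (phi & psi & psihat & b & P & Q & R & E).
    exists (fun k => swap (phi k)), (fun k => swap (psihat k)), (fun k => swap (psi k)), b.
    split; [now apply phihat_swap|split; [now apply psihat_swap|split; [now apply psi_swap|]]].
    intros k. rewrite E. unfold vadd, scale, swap; simpl. f_equal; apply Cplus_comm.
  - intros (phi & psi & psihat & b & P & Q & R & E).
    assert (W : forall nu : Z -> C * C, (fun k => swap (swap (nu k))) = nu).
    { intros nu. apply functional_extensionality. intros k. apply swap_swap. }
    exists (fun k => swap (phi k)), (fun k => swap (psihat k)), (fun k => swap (psi k)), b.
    split; [|split; [|split]].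
    + apply phihat_swap; auto. now rewrite W.
    + apply psi_swap; auto. now rewrite W.
    + apply psihat_swap; auto. now rewrite W.
    + intros k. rewrite E. unfold vadd, scale, swap; simpl. f_equal; apply Cplus_comm.
Qed.

Lemma resolvent_Linv (q r : Z -> C) (U : C -> Prop) (lg : C -> C)
  (Hq : vanishes_rapidly q) (Hr : vanishes_rapidly r)
  (Hqr : forall k : Z, RtoC 1 - r k * q k <> RtoC 0)
  (Hlg : log_branch U lg) (HU1 : U (RtoC 1)) :
  exists R0 : R, (0 < R0 <= 1)%R /\
    forall z : C, (0 < Cmod z < R0)%R ->
    exists dlogahat : Z -> C * C,
      (forall k : Z, is_vderiv (fun q' r' => lg (scat_ahat q' r' z)) q r k (dlogahat k)) /\
      is_resolvent (opLinv q r) (zpow z 2) (fun k => (r k, q k))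
        (fun k => scale (RtoC 1 - r k * q k) (vadd (dlogahat k) (grad_H0 q r k))).
Proof.
  destruct (resolvent_L r q U lg Hr Hq) as [R1 [HR1 H]]; auto.
  { intros k. replace (RtoC 1 - q k * r k) with (RtoC 1 - r k * q k) by ring. auto. }
  exists (/ R1)%R. split.
  { split; [apply Rinv_0_lt_compat; lra|].
    rewrite <- Rinv_1. apply Rinv_le_contravar; lra. }
  intros z [Hz1 Hz2].
  assert (Hz0 : z <> RtoC 0) by now apply Cmod_gt_0.
  destruct (H (/ z)) as [d [Hd Hres]].
  { rewrite Cmod_inv by auto. rewrite <- (Rinv_inv R1). apply Rinv_lt_contravar; auto.
    apply Rmult_lt_0_compat; auto. apply Rinv_0_lt_compat; lra. }
  exists (fun k => swap (d k)). split.
  - intros k. destruct (Hd k) as [D1 D2].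
    split; [apply is_derive_ext with (2 := D2)|apply is_derive_ext with (2 := D1)];
      intros t; now rewrite scat_ahat_eq.
  - rewrite zpow_inv in Hres by auto. simpl Z.opp in Hres.
    replace (fun k => scale (RtoC 1 - r k * q k) (vadd (swap (d k)) (grad_H0 q r k)))
      with (fun k => swap (scale (RtoC 1 - q k * r k) (vadd (d k) (grad_H0 r q k)))).
    + exact (resolvent_swap q r _ _ _ Hres).
    + apply functional_extensionality. intros k.
      unfold swap, scale, vadd, grad_H0; simpl. now rewrite (Cmult_comm (q k) (r k)).
Qed.

Theorem theorem2 (q r : Z -> C) (U : C -> Prop) (lg : C -> C)
  (Hq : vanishes_rapidly q) (Hr : vanishes_rapidly r)
  (Hqr : forall k : Z, RtoC 1 - r k * q k <> RtoC 0)
  (Hlg : log_branch U lg) (HU1 : U (RtoC 1)) (Hlg1 : lg (RtoC 1) = RtoC 0)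
  (HU : forall k : Z, U (RtoC 1 - r k * q k)) :
  exists dH0 : Z -> C * C,
    (forall k : Z, is_vderiv (H0 lg) q r k (dH0 k)) /\
    (exists R1 : R, (1 <= R1)%R /\
      forall z : C, (R1 < Cmod z)%R ->
      exists dloga : Z -> C * C,
        (forall k : Z,
          is_vderiv (fun q' r' => lg (scat_a q' r' z)) q r k (dloga k)) /\
        is_resolvent (opL q r) (zpow z (-2)) (fun k => (r k, q k))
          (fun k => scale (RtoC 1 - r k * q k) (vadd (dloga k) (dH0 k)))) /\
    (exists R0 : R, (0 < R0 <= 1)%R /\
      forall z : C, (0 < Cmod z < R0)%R ->
      exists dlogahat : Z -> C * C,
        (forall k : Z,
          is_vderiv (fun q' r' => lg (scat_ahat q' r' z)) q r k (dlogahat k)) /\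
        is_resolvent (opLinv q r) (zpow z 2) (fun k => (r k, q k))
          (fun k => scale (RtoC 1 - r k * q k) (vadd (dlogahat k) (dH0 k)))).
Proof.
  destruct (proj2 (pot_le_iff q r)) as [S HS].
  { destruct (vanishes_Zsum_le q Hq) as [A HA]. destruct (vanishes_Zsum_le r Hr) as [B HB]. eauto. }
  exists (grad_H0 q r). split; [|split].
  - intros k. now apply H0_vderiv with U S.
  - now apply resolvent_L with U.
  - now apply resolvent_Linv with U.
Qed.
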